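(* Let $\chi_8$ be the primitive even Dirichlet character modulo $8$. Then $\zeta_2(2)$, $\zeta_3(2)$ and $L_2(2,\chi_8)$ are irrational, i.e. $\zeta_2(2)\in\mathbb{Q}_2\setminus\mathbb{Q}$, $\zeta_3(2)\in\mathbb{Q}_3\setminus\mathbb{Q}$ and $L_2(2,\chi_8)\in\mathbb{Q}_2\setminus\mathbb{Q}$.
   Context: Bernoulli numbers: $\frac{t}{e^t-1}=\sum_{n\ge0}B_n\frac{t^n}{n!}$. Teichmüller character $\omega:\mathbb{Z}\to\mathbb{Z}_p$: $\omega(m)=0$ if $p\mid m$; if $p$ is odd and $p\nmid m$, $\omega(m)$ is the unique element of $\mathbb{Z}_p$ with $\omega(m)^{p-1}=1$ and $\omega(m)\equiv m \pmod p$; if $p=2$ and $m$ is odd, $\omega(m)=(-1)^{(m-1)/2}$. For $p\nmid m$ put $\langle m\rangle=\omega(m)^{-1}m$. $p$-adic Hurwitz zeta function: for a positive integer $F$ divisible by $p$, an integer $a$ not divisible by $p$, and $s\in\mathbb{Z}_p$, $s\neq1$, $$H_p(s,a,F)=\frac{1}{F(s-1)}\langle a\rangle^{1-s}\sum_{j=0}^\infty\binom{1-s}{j}B_j\left(\frac Fa\right)^j .$$ Kubota–Leopoldt $p$-adic $L$-series: for $\phi:\mathbb{Z}\to\overline{\mathbb{Q}}$ periodic with period $f$, let $F=\mathrm{lcm}(f,p)$ if $p$ is odd and $F=\mathrm{lcm}(f,4)$ if $p=2$, and set $$L_p(s,\phi)=\sum_{1\le a\le F,\ p\nmid a}\phi(a)H_p(s,a,F).$$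 $\zeta_p(s)$ denotes $L_p(s,\phi)$ for $\phi\equiv1$; thus $\zeta_p(s)=\sum_{a=1}^{p-1}H_p(s,a,p)$ for $p$ odd and $\zeta_2(s)=H_2(s,1,4)+H_2(s,3,4)$. The character $\chi_8$ has $\chi_8(1)=\chi_8(7)=1$, $\chi_8(3)=\chi_8(5)=-1$, and vanishes on even integers. *)

(* Defs.v *)
From HB Require Import structures.
From mathcomp Require Import all_boot all_order all_algebra.
From mathcomp Require Import generic_quotient fraction.
From mathcomp Require Import boolp classical_sets filter topology sequences.

Set Implicit Arguments.
Unset Strict Implicit.
Unset Printing Implicit Defensive.
Import Order.TTheory GRing.Theory Num.Theory.
Local Open Scope ring_scope.

(* The ring Z_p as the inverse limit of the Z/p^n: x is represented by the
   sequence of its residues 0 <= x_n < p^n; the coherence condition also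
   enforces that x_n is reduced. The primality proof is carried by the type so
   that the domain structure can be inferred. *)
Definition coherent (p : nat) (x : nat -> int) :=
  forall n, x n = (x n.+1 %% (p ^ n)%:Z)%Z.

Record padic_int (p : nat) (pp : prime p) := PadicInt {
  residues :> nat -> int;
  residuesP : `[< coherent p residues >] }.

Section PadicInt.
Variables (p : nat) (pp : prime p).
Local Notation Zp := (padic_int pp).
Local Notation q n := ((p ^ n)%:Z).

HB.instance Definition _ := [isSub for @residues p pp].
HB.instance Definition _ := [Choice of Zp by <:].

Lemma expz_p_gt0 n : 0 < q n.
Proof. by rewrite ltz_nat expn_gt0 prime_gt0. Qed.
Lemma expz_p_neq0 n : q n != 0. Proof. by rewrite gt_eqF// expz_p_gt0. Qed.
Lemma expz_p_dvd m n : (m <= n)%N -> (q m %| q n)%Z.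
Proof. by move=> mn; rewrite dvdzE/= dvdn_exp2l. Qed.
Lemma expz_p_eqmod m n (a b : int) :
  (m <= n)%N -> (a = b %[mod q n])%Z -> (a = b %[mod q m])%Z.
Proof.
move=> mn /eqP; rewrite eqz_mod_dvd => h.
by apply/eqP; rewrite eqz_mod_dvd (dvdz_trans (expz_p_dvd mn)).
Qed.

Lemma padic_intE (x : Zp) n : x n = (x n.+1 %% q n)%Z.
Proof. by case: x => x /= /asboolP; apply. Qed.

Lemma padic_int_mod (x : Zp) n : (x n %% q n)%Z = x n.
Proof. by rewrite padic_intE modz_mod. Qed.

Lemma padic_int_modle (x : Zp) m n : (m <= n)%N -> (x n %% q m)%Z = x m.
Proof.
elim: n => [|n IHn]; first by rewrite leqn0 => /eqP ->; exact: padic_int_mod.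
rewrite leq_eqVlt => /orP[/eqP ->|]; first exact: padic_int_mod.
rewrite ltnS => mn; rewrite -(IHn mn); apply: (expz_p_eqmod mn).
by rewrite (padic_intE x n) modz_mod.
Qed.

Lemma padic_int_inj (x y : Zp) : (forall n, x n = y n) -> x = y.
Proof. by move=> xy; apply: val_inj; apply/funext. Qed.

Lemma coherent_mod (f : nat -> int) :
  (forall n, (f n.+1 = f n %[mod q n])%Z) ->
  `[< coherent p (fun n => (f n %% q n)%Z) >].
Proof.
move=> fP; apply/asboolP => n; rewrite -fP.
by apply: (expz_p_eqmod (leqnSn n)); rewrite modz_mod.
Qed.

Definition padic_of_seq f fP : Zp := PadicInt pp (@coherent_mod f fP).

Lemma padic_int_step (x : Zp) n : (x n.+1 = x n %[mod q n])%Z.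
Proof. by rewrite (padic_intE x n) modz_mod. Qed.

Lemma padic_int_const_step (c : int) n : (c = c %[mod q n])%Z. Proof. by []. Qed.
Lemma padic_int_add_step (x y : Zp) n : (x n.+1 + y n.+1 = x n + y n %[mod q n])%Z.
Proof. by rewrite -modzDm !padic_int_step modzDm. Qed.
Lemma padic_int_mul_step (x y : Zp) n : (x n.+1 * y n.+1 = x n * y n %[mod q n])%Z.
Proof. by rewrite -modzMm !padic_int_step modzMm. Qed.
Lemma padic_int_opp_step (x : Zp) n : (- x n.+1 = - x n %[mod q n])%Z.
Proof. by rewrite -modzNm padic_int_step modzNm. Qed.

Definition padic_int_zero := padic_of_seq (padic_int_const_step 0).
Definition padic_int_one := padic_of_seq (padic_int_const_step 1).
Definition padic_int_add x y := padic_of_seq (padic_int_add_step x y).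
Definition padic_int_mul x y := padic_of_seq (padic_int_mul_step x y).
Definition padic_int_opp x := padic_of_seq (padic_int_opp_step x).

Fact padic_int_addA : associative padic_int_add.
Proof.
by move=> x y z; apply: padic_int_inj => n /=; rewrite modzDmr modzDml addrA.
Qed.
Fact padic_int_addC : commutative padic_int_add.
Proof. by move=> x y; apply: padic_int_inj => n /=; rewrite addrC. Qed.
Fact padic_int_add0 : left_id padic_int_zero padic_int_add.
Proof.
by move=> x; apply: padic_int_inj => n /=; rewrite modzDml add0r padic_int_mod.
Qed.
Fact padic_int_addN : left_inverse padic_int_zero padic_int_opp padic_int_add.
Proof. by move=> x; apply: padic_int_inj => n /=; rewrite modzDml addNr. Qed.

HB.instance Definition _ := GRing.isZmodule.Build Zp
  padic_int_addA padic_int_addC padic_int_add0 padic_int_addN.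

Fact padic_int_mulA : associative padic_int_mul.
Proof.
by move=> x y z; apply: padic_int_inj => n /=; rewrite modzMmr modzMml mulrA.
Qed.
Fact padic_int_mulC : commutative padic_int_mul.
Proof. by move=> x y; apply: padic_int_inj => n /=; rewrite mulrC. Qed.
Fact padic_int_mul1 : left_id padic_int_one padic_int_mul.
Proof.
by move=> x; apply: padic_int_inj => n /=; rewrite modzMml mul1r padic_int_mod.
Qed.
Fact padic_int_mulD : left_distributive padic_int_mul padic_int_add.
Proof.
move=> x y z; apply: padic_int_inj => n /=.
by rewrite modzMml modzDm mulrDl.
Qed.
Fact padic_int_one_neq0 : padic_int_one != 0.
Proof.
apply/eqP => /(congr1 (fun x : Zp => x 1%N)) /=.
by rewrite expn1 mod0z modz_small// ltz_nat prime_gt1.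
Qed.

HB.instance Definition _ := GRing.Zmodule_isComNzRing.Build Zp
  padic_int_mulA padic_int_mulC padic_int_mul1 padic_int_mulD
  padic_int_one_neq0.

Lemma padic_int0E n : (0 : Zp) n = 0. Proof. exact: mod0z. Qed.
Lemma padic_intDE (x y : Zp) n : (x + y) n = ((x n + y n) %% q n)%Z.
Proof. by []. Qed.
Lemma padic_intNE (x : Zp) n : (- x) n = (- x n %% q n)%Z.
Proof. by []. Qed.
Lemma padic_intME (x y : Zp) n : (x * y) n = ((x n * y n) %% q n)%Z.
Proof. by []. Qed.

Definition padic_int_unit : {pred Zp} := fun x => `[< exists y, y * x = 1 >].
Definition padic_int_inv (x : Zp) : Zp :=
  if x \in padic_int_unit then xget x [set y | y * x = 1]%classic else x.

Fact padic_int_mulV : {in padic_int_unit, left_inverse 1 padic_int_inv *%R}.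
Proof.
move=> x xu; rewrite /padic_int_inv xu.
exact: (@xgetPex _ x [set y | y * x = 1]%classic (asboolP _ xu)).
Qed.
Fact padic_int_unitP (x y : Zp) : y * x = 1 -> x \in padic_int_unit.
Proof. by move=> yx; apply/asboolP; exists y. Qed.
Fact padic_int_invN : {in [predC padic_int_unit], padic_int_inv =1 id}.
Proof. by move=> x /negbTE xu; rewrite /padic_int_inv xu. Qed.

HB.instance Definition _ := GRing.ComNzRing_hasMulInverse.Build Zp
  padic_int_mulV padic_int_unitP padic_int_invN.

Lemma padic_int_eq0P (x : Zp) : reflect (exists n, x n != 0) (x != 0).
Proof.
apply: (iffP idP) => [|[n]].
  apply: contraNP => /forallNP h; apply/eqP/padic_int_inj => n.
  by rewrite padic_int0E; apply/eqP/negPn/negP/h.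
by apply: contraNneq => ->; rewrite padic_int0E.
Qed.

Lemma padic_int_eq0 (x : Zp) m n :
  (m <= n)%N -> (x m == 0) = (p ^ m %| `|x n|)%N.
Proof.
move=> mn; rewrite -(padic_int_modle x mn).
by rewrite -[(_ %| _)%N]/((q m %| x n)%Z); apply/eqP/dvdz_mod0P.
Qed.

Lemma padic_int_eq0_le (x : Zp) m n : (m <= n)%N -> x n = 0 -> x m = 0.
Proof. by move=> mn xn; rewrite -(padic_int_modle x mn) xn mod0z. Qed.

(* The p-adic valuation: the largest n such that x is 0 modulo p^n, for
   x != 0; junk value 0 at x = 0. *)
Definition padic_int_val (x : Zp) : nat :=
  if pselect (exists n, x n.+1 != 0) is left h then ex_minn h else 0%N.

Lemma padic_int_valP (x : Zp) n :
  x != 0 -> (x n == 0) = (n <= padic_int_val x)%N.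
Proof.
move=> /padic_int_eq0P x0.
have x00 : x 0%N = 0 by rewrite -[x 0%N]padic_int_mod expn0 modz1.
have {}x0 : exists n, x n.+1 != 0.
  by case: x0 => -[|m xm]; [rewrite x00 eqxx|exists m].
rewrite /padic_int_val; case: pselect => // h; case: ex_minnP => m xm mP.
apply/idP/idP => [/eqP xn|].
  by rewrite leqNgt; apply: contra xm => mn; rewrite (padic_int_eq0_le mn xn).
case: n => [|n nm]; first by rewrite x00.
by apply: contraTT nm => /mP; rewrite -ltnNge ltnS.
Qed.

Lemma padic_int_val_logn (x : Zp) k :
  x k != 0 -> padic_int_val x = logn p `|x k|.
Proof.
move=> xk; have x0 : x != 0 by apply/padic_int_eq0P; exists k.
have xk0 : (0 < `|x k|)%N by rewrite absz_gt0.
have vk : (padic_int_val x < k)%N by rewrite ltnNge -padic_int_valP.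
apply/eqP; rewrite eqn_leq; apply/andP; split.
  by rewrite -pfactor_dvdn// -(padic_int_eq0 x (ltnW vk)) padic_int_valP.
have lk : (logn p `|x k| <= k)%N.
  rewrite leqNgt; apply/negP => kl; move/negP: xk; apply.
  by rewrite (padic_int_eq0 x (leqnn k)) pfactor_dvdn// ltnW.
by rewrite -padic_int_valP// (padic_int_eq0 x lk) pfactor_dvdn.
Qed.

Lemma padic_int_mul_neq0 (x y : Zp) :
  x != 0 -> y != 0 ->
  exists2 k, [/\ x k != 0, y k != 0 & (x * y) k != 0] &
    logn p `|(x * y) k| = (logn p `|x k| + logn p `|y k|)%N.
Proof.
move=> x0 y0; set m := padic_int_val x; set n := padic_int_val y.
have [xm yn] : x m.+1 != 0 /\ y n.+1 != 0 by rewrite !padic_int_valP// !ltnn.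
pose k := (m + n).+1.
have xk : x k != 0.
  by apply: contraNneq xm => /(@padic_int_eq0_le x m.+1)->//; rewrite ltnS leq_addr.
have yk : y k != 0.
  by apply: contraNneq yn => /(@padic_int_eq0_le y n.+1)->//; rewrite ltnS leq_addl.
have lxy : logn p `|x k * y k| = (m + n)%N.
  by rewrite abszM lognM ?absz_gt0// -!padic_int_val_logn.
have xyk : (x * y) k != 0.
  apply/eqP => /dvdz_mod0P; rewrite dvdzE [`|q k|%N]/= pfactor_dvdn//.
    by rewrite lxy ltnn.
  by rewrite absz_gt0 mulf_neq0.
exists k => //.
rewrite -(padic_int_val_logn xk) -(padic_int_val_logn yk) -/m -/n -lxy.
have dvdE j : (j <= k)%N ->
    (p ^ j %| `|((x * y)%R : Zp) k|)%N = (p ^ j %| `|(x k * y k)%R|)%N.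
  move=> jk; suff h : (q j %| (x * y) k)%Z = (q j %| x k * y k)%Z by exact: h.
  rewrite padic_intME; apply/dvdz_mod0P/dvdz_mod0P => <-;
    by apply: (expz_p_eqmod jk); rewrite modz_mod.
have xy0 : (0 < `|(x k * y k)%R|)%N by rewrite absz_gt0 mulf_neq0.
have xyk0 : (0 < `|((x * y)%R : Zp) k|)%N by rewrite absz_gt0.
apply/eqP; rewrite eqn_leq -!pfactor_dvdn//; apply/andP; split; last first.
  by rewrite dvdE ?pfactor_dvdn// lxy /k leqW.
rewrite -dvdE ?pfactor_dvdn//.
rewrite -padic_int_val_logn// leqNgt; apply/negP => h.
move/negP: (xyk); apply; rewrite padic_int_valP ?(ltnW h)//.
by apply/padic_int_eq0P; exists k.
Qed.

Fact padic_int_domain : GRing.integral_domain_axiom Zp.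
Proof.
move=> x y xy; apply: contraPT xy => /norP[x0 y0] xy.
by have [k []] := padic_int_mul_neq0 x0 y0; rewrite xy padic_int0E eqxx.
Qed.

HB.instance Definition _ :=
  GRing.ComUnitRing_isIntegral.Build Zp padic_int_domain.

Lemma padic_int_valM (x y : Zp) : x != 0 -> y != 0 ->
  padic_int_val (x * y) = (padic_int_val x + padic_int_val y)%N.
Proof.
move=> x0 y0; have [k [xk yk xyk] e] := padic_int_mul_neq0 x0 y0.
by rewrite !(@padic_int_val_logn _ k).
Qed.

Definition padic_int_norm (x : Zp) : rat :=
  if x == 0 then 0 else p%:R ^- padic_int_val x.

Lemma ratp_gt0 : 0 < p%:R :> rat. Proof. by rewrite ltr0n prime_gt0. Qed.

Lemma padic_int_norm_ge0 x : 0 <= padic_int_norm x.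
Proof.
by rewrite /padic_int_norm; case: eqP => // _; rewrite invr_ge0 exprn_ge0// ltW// ratp_gt0.
Qed.

Lemma padic_int_norm_eq0 x : (padic_int_norm x == 0) = (x == 0).
Proof.
rewrite /padic_int_norm; case: (eqVneq x 0) => // _.
by rewrite invr_eq0 expf_eq0 gt_eqF ?ratp_gt0 ?andbF.
Qed.

Lemma padic_int_normM x y :
  padic_int_norm (x * y) = padic_int_norm x * padic_int_norm y.
Proof.
rewrite /padic_int_norm mulf_eq0.
case: (eqVneq x 0) => x0; first by rewrite mul0r.
case: (eqVneq y 0) => y0; first by rewrite mulr0.
by rewrite padic_int_valM// exprD invfM.
Qed.

Lemma padic_int_norm_leP (x : Zp) n :
  reflect (x n = 0) (padic_int_norm x <= p%:R ^- n).
Proof.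
rewrite /padic_int_norm; case: (eqVneq x 0) => [->|x0].
  by rewrite invr_ge0 exprn_ge0 ?(ltW ratp_gt0)//; constructor; rewrite padic_int0E.
rewrite lef_pV2 ?posrE ?exprn_gt0 ?ratp_gt0// ler_eXn2l ?ltr1n ?prime_gt1//.
by rewrite -padic_int_valP//; exact: eqP.
Qed.

Lemma padic_int_normN x : padic_int_norm (- x) = padic_int_norm x.
Proof.
suff h y : padic_int_norm (- y) <= padic_int_norm y.
  by apply/eqP; rewrite eq_le h/=; have := h (- x); rewrite opprK.
case: (eqVneq y 0) => [->|y0]; first by rewrite oppr0.
rewrite {2}/padic_int_norm (negbTE y0); apply/padic_int_norm_leP.
by rewrite padic_intNE (eqP (_ : y _ == 0)) ?oppr0 ?mod0z// padic_int_valP.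
Qed.

Lemma padic_int_normD x y :
  padic_int_norm (x + y) <= Num.max (padic_int_norm x) (padic_int_norm y).
Proof.
wlog xy : x y / padic_int_norm x <= padic_int_norm y.
  move=> h; case: (leP (padic_int_norm x) (padic_int_norm y)) => xy.
    by have := h _ _ xy; rewrite max_r.
  by have := h _ _ (ltW xy); rewrite addrC max_r ?(ltW xy).
rewrite max_r//; case: (eqVneq y 0) xy => [->|y0].
  by rewrite addr0.
rewrite {2 4}/padic_int_norm (negbTE y0) => /padic_int_norm_leP xn.
apply/padic_int_norm_leP; rewrite padic_intDE xn add0r.
by rewrite (eqP (_ : y _ == 0)) ?mod0z// padic_int_valP.
Qed.

End PadicInt.

(* The field Q_p, with its p-adic absolute value (normalised by |p| = 1/p, with
   values in rat) and the metric it induces. *)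
Section Padic.
Variables (p : nat) (pp : prime p).
Local Notation Zp := (padic_int pp).

Definition padic : Type := {fraction Zp}.
HB.instance Definition _ := GRing.Field.on padic.
HB.instance Definition _ := isPointed.Build padic 0.

Definition padic_of_int (x : Zp) : padic := FracField.tofrac x.
HB.instance Definition _ := GRing.RMorphism.copy padic_of_int
  (@FracField.tofrac Zp).

Definition padic_norm (x : padic) : rat :=
  padic_int_norm (\n_(repr (x : {fraction Zp}))) /
  padic_int_norm (\d_(repr (x : {fraction Zp}))).

Lemma padic_of_int_eq0 (x : Zp) : (padic_of_int x == 0) = (x == 0).
Proof. exact: tofrac_eq0. Qed.

Lemma padic_repr (x : padic) :
  exists2 d : Zp, d != 0 & exists2 n : Zp,
    x = padic_of_int n / padic_of_int d &
    padic_norm x = padic_int_norm n / padic_int_norm d.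
Proof.
exists (\d_(repr (x : {fraction Zp}))); first exact: denom_ratioP.
exists (\n_(repr (x : {fraction Zp}))) => //.
set r := repr _; have dr : \d_r != 0 by exact: denom_ratioP.
have dr' : padic_of_int \d_r != 0 by rewrite padic_of_int_eq0.
apply: (mulIf dr'); rewrite divfK// -[x](@reprK _ {fraction Zp}) -/r.
rewrite /padic_of_int; unlock FracField.tofrac.
rewrite -[LHS]FracField.pi_mul; apply/eqmodP => /=.
rewrite FracField.equivfE /FracField.mulf.
by rewrite !numden_Ratio ?mulf_neq0 ?oner_eq0// !mulr1 mulrC.
Qed.

Lemma padic_norm_frac (n d : Zp) : d != 0 ->
  padic_norm (padic_of_int n / padic_of_int d) =
  padic_int_norm n / padic_int_norm d.
Proof.
move=> d0; have [d' d'0 [n' e ->]] :=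
  padic_repr (padic_of_int n / padic_of_int d).
have nd (u : Zp) : u != 0 -> padic_int_norm u != 0.
  by rewrite padic_int_norm_eq0.
apply/eqP; rewrite eqr_div ?nd// -!padic_int_normM; apply/eqP; congr padic_int_norm.
apply/eqP; move/eqP: e; rewrite eq_sym eqr_div ?padic_of_int_eq0//.
by rewrite -!rmorphM/= /padic_of_int tofrac_eq.
Qed.

Lemma padic_norm_int (x : Zp) : padic_norm (padic_of_int x) = padic_int_norm x.
Proof.
have n1 : padic_int_norm (1 : Zp) = 1.
  apply: (mulIf (_ : padic_int_norm (1 : Zp) != 0)).
    by rewrite padic_int_norm_eq0 oner_eq0.
  by rewrite -padic_int_normM !mul1r.
rewrite -[padic_of_int x]divr1 -(rmorph1 (@padic_of_int)).
by rewrite padic_norm_frac ?oner_eq0// n1 divr1.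
Qed.

Lemma padic_norm_ge0 x : 0 <= padic_norm x.
Proof. by rewrite divr_ge0// padic_int_norm_ge0. Qed.

Lemma padic_norm_eq0 x : (padic_norm x == 0) = (x == 0).
Proof.
have [d d0 [n -> ->]] := padic_repr x.
rewrite !mulf_eq0 !invr_eq0 !padic_int_norm_eq0 !padic_of_int_eq0.
by [].
Qed.

Lemma padic_normM x y : padic_norm (x * y) = padic_norm x * padic_norm y.
Proof.
have [d d0 [n -> ->]] := padic_repr x; have [e e0 [m -> ->]] := padic_repr y.
rewrite mulf_div -!rmorphM/= padic_norm_frac ?mulf_neq0//.
by rewrite !padic_int_normM mulf_div.
Qed.

Lemma padic_normN x : padic_norm (- x) = padic_norm x.
Proof.
have [d d0 [n -> ->]] := padic_repr x.
by rewrite -mulNr -rmorphN/= padic_norm_frac// padic_int_normN.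
Qed.

Lemma padic_normD x y :
  padic_norm (x + y) <= Num.max (padic_norm x) (padic_norm y).
Proof.
have [d d0 [n -> ->]] := padic_repr x; have [e e0 [m -> ->]] := padic_repr y.
rewrite addf_div ?padic_of_int_eq0// -!(rmorphM, rmorphD)/=.
rewrite padic_norm_frac ?mulf_neq0//.
have pn (u : Zp) : u != 0 -> 0 < padic_int_norm u.
  by move=> u0; rewrite lt_def padic_int_norm_eq0 u0 padic_int_norm_ge0.
rewrite ler_pdivrMr ?pn ?mulf_neq0// padic_int_normM maxr_pMl; last first.
  by rewrite mulr_ge0// padic_int_norm_ge0.
rewrite [X in Num.max X _]mulrA divfK ?gt_eqF ?pn//.
rewrite [X in Num.max _ X]mulrCA divfK ?gt_eqF ?pn// -!padic_int_normM.
by rewrite [d * m]mulrC padic_int_normD.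
Qed.

Definition padic_dist (x y : padic) : rat := padic_norm (x - y).

Fact padic_dist0 x : padic_dist x x = 0.
Proof. by apply/eqP; rewrite /padic_dist subrr padic_norm_eq0. Qed.
Fact padic_dist_eq0 x y : padic_dist x y = 0 -> x = y.
Proof. by move/eqP; rewrite padic_norm_eq0 subr_eq0 => /eqP. Qed.
Fact padic_distC x y : padic_dist x y = padic_dist y x.
Proof. by rewrite /padic_dist -opprB padic_normN. Qed.
Fact padic_distD y x z : padic_dist x z <= padic_dist x y + padic_dist y z.
Proof.
rewrite /padic_dist -[x - z](subrKA y); apply: (le_trans (padic_normD _ _)).
by rewrite ge_max lerDl lerDr !padic_norm_ge0.
Qed.

HB.instance Definition _ := @isMetric.Build rat padic padic_dist
  padic_dist0 padic_dist_eq0 padic_distC padic_distD.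

End Padic.

(* Bernoulli numbers. The coefficients b_n = B_n / n! are those of the
   quotient of formal power series 1 / ((e^t - 1) / t), computed by the usual
   recursion; [bernoulli_gen] is the defining identity
   (sum_n B_n t^n / n!) * ((e^t - 1) / t) = 1, coefficient by coefficient. *)
Fixpoint bernoulli_coefs (n : nat) : seq rat :=
  if n is m.+1 then
    let s := bernoulli_coefs m in
    rcons s ((m == 0)%:R - \sum_(k < m) s`_k / (m - k).+1`!%:R)
  else [::].

Definition bernoulli (n : nat) : rat := n`!%:R * (bernoulli_coefs n.+1)`_n.

Lemma bernoulli_gen (n : nat) :
  \sum_(k < n.+1) bernoulli k / k`!%:R * (n - k).+1`!%:R^-1 = (n == 0)%:R.
Proof.
have sz m : size (bernoulli_coefs m) = m.
  by elim: m => //= m IH; rewrite size_rcons IH.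
have nthE m k : (k < m)%N ->
    (bernoulli_coefs m)`_k = (bernoulli_coefs k.+1)`_k.
  elim: m => // m IH; rewrite ltnS leq_eqVlt => /orP[/eqP ->//|km].
  by rewrite [LHS]/= nth_rcons sz km IH.
have bE k : bernoulli k / k`!%:R = (bernoulli_coefs k.+1)`_k.
  by rewrite /bernoulli mulrAC divff ?mul1r// pnatr_eq0 -lt0n fact_gt0.
rewrite big_ord_recr/= subnn bE divr1 [X in _ + X]/= nth_rcons sz ltnn eqxx.
under eq_bigr do rewrite bE -(nthE n)//.
by rewrite addrC subrK.
Qed.

Section PadicL.
Variables (p : nat) (pp : prime p).
Local Notation Zp := (padic_int pp).
Local Notation Qp := (padic pp).

(* The sum of a p-adic series; junk value when the series diverges. *)
Definition padic_series (u : nat -> Qp) : Qp := limn (series u).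

(* For p odd and m prime to p the Teichmueller representative is characterised
   by a property that has exactly one solution; [xget] returns it. For p = 2,
   the exponent (m - 1) / 2 is an exact quotient in int. *)
Definition teichmuller (m : int) : Zp :=
  if (p%:Z %| m)%Z then 0
  else if p == 2%N then (-1) ^ ((m - 1) %/ 2)%Z
  else xget 0 [set w : Zp | w ^+ p.-1 = 1 /\ (w 1%N = m %[mod p%:Z])%Z]%classic.

(* <m> = omega(m)^-1 m, used for m prime to p only. *)
Definition padic_angle (m : int) : Qp := (padic_of_int (teichmuller m))^-1 * m%:~R.

Definition padic_binomial (s : Qp) (j : nat) : Qp :=
  (\prod_(i < j) (s - i%:R)) / j`!%:R.

(* x ^ s for x = 1 modulo p and s in Z_p, by the binomial series. *)
Definition padic_pow (x : Qp) (s : Zp) : Qp :=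
  padic_series (fun j => padic_binomial (padic_of_int s) j * (x - 1) ^+ j).

(* Meaningful for F > 0 divisible by p, a prime to p and s != 1. *)
Definition padic_hurwitz (s : Zp) (a : int) (F : nat) : Qp :=
  (F%:R * (padic_of_int s - 1))^-1 * padic_pow (padic_angle a) (1 - s) *
  padic_series (fun j => padic_binomial (padic_of_int (1 - s)) j *
                         ratr (bernoulli j) * (F%:R / a%:~R) ^+ j).

(* phi is meant to be periodic of period f > 0, with values in Q_p (algebraic
   values outside Q_p are not needed). *)
Definition padic_L (s : Zp) (f : nat) (phi : int -> Qp) : Qp :=
  let F := if p == 2%N then lcmn f 4 else lcmn f p in
  \sum_(1 <= a < F.+1 | ~~ (p %| a)%N) phi a%:Z * padic_hurwitz s a%:Z F.

Definition padic_zeta (s : Zp) : Qp := padic_L s 1 (fun _ => 1).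

Definition padic_irrational (x : Qp) := ~ exists r : rat, x = ratr r.

End PadicL.

Arguments padic_L {p} pp s f phi.
Arguments padic_zeta {p} pp s.

Definition prime2 : prime 2 := isT.
Definition prime3 : prime 3 := isT.

Definition chi8 (a : int) : int :=
  match `|(a %% 8)%Z|%N with
  | 1%N | 7%N => 1
  | 3%N | 5%N => -1
  | _ => 0
  end.

(* Main.v *)
From HB Require Import structures.
Require Import Defs.
From mathcomp Require Import all_boot all_order all_algebra.
From mathcomp Require Import zify ring lra.
From mathcomp Require Import boolp classical_sets filter topology sequences.

Set Implicit Arguments.
Unset Strict Implicit.
Unset Printing Implicit Defensive.
Import Order.TTheory GRing.Theory Num.Theory.
Local Open Scope ring_scope.

(** The three numbers are values of one function, for which Stieltjes found a
    continued fraction; its convergents approach the value $p$-adically faster than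
    their common denominators grow.

    At $s = 2$ the Hurwitz function $H_p(2,a,F)$ is $\omega(a)/F^2$ times
    $\tau(a/F)$, where $\tau(x) = \sum_j(-1)^jB_jx^{-j-1}$ ([hurwitz_at_2]). Let
    $\Theta(x) = (\tau(x/2)-\tau((x+1)/2))/4$, the $p$-adic $\sum_n(-1)^n/(x+n)^2$. By the
    difference and duplication equations of $\tau$, each of the three values is
    $u+v(\Theta(x)-\Theta(-x))$ with rational $u$ and $v\ne0$, for $x = 1/2$ (with
    $\zeta_2$), $1/3$ (with $\zeta_3$) and $1/4$ (with $\chi_8$). Now
    $x(\Theta(x)-\Theta(-x))$ is the Newton series
    $$\alpha = \sum_i\frac{(-1)^i\,i!^2}{\prod_{j\le i}(y-j^2)},\qquad y = x^2$$
    ([newton_sum_cvg]). To see this, $\tau$ is written as the value at $1/(x+t)$ of the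
    linear functional $t^j\mapsto B_j$, and $\Theta$ as that of the functional whose
    moments are the Genocchi numbers. Both are controlled by the Gauss norm
    ([bernoulli_fun_le]), so that every sequence of polynomials tending to $1/(x+t)$
    computes the same limit ([inv_approx_near]); a functional equation of $\tau$ is then
    a substitution in polynomials, and the series for $\alpha$ comes from Newton
    interpolation at the squares.

    Let $e_k = \binom xk\binom{x+k-1}k$, let $S_k$ be the $k$-th partial sum of
    $\alpha$, and put $Q_n = \sum_k\binom nke_k$, $P_n = \sum_k\binom nke_kS_k$. Both
    satisfy
    $$(n+1)^2(u_{n+1}-u_n) = n(n+1)(u_n-u_{n-1})+y\,u_n$$
    ([apery_rec]). Hence $P_n$ and $Q_n$ lie in $[0,n+1]$ when $0\le y\le1$
    ([apery_bound]), and $P_{n+1}Q_n-P_nQ_{n+1} = 1/(n+1)$ ([approx_casoratian]).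
    $p$-adically the last term of $Q_n$ dominates, the differences of consecutive
    convergents decrease strictly, and the ultrametric inequality turns the Casoratian into
    the exact value of $|Q_n\alpha-P_n|_p$, which is at most
    $|n!|_p^2\,|y|_p^{-n-1}$ and does not vanish.

    With $x = b/p^r$ and $g_n = p^{rn+v_p(n!)}$, both $P_n$ and $Q_n$ become integers after
    multiplication by $d_n^2g_n^2$, where $d_n$ is the least common multiple of
    $1,\dots,n$ ([approx_num_clear]). If $\alpha$ were rational, a nonzero integer of
    size $O(n\,d_n^2g_n^2)$ would be divisible by $g_n^4$, so that
    $g_n^2 = O(n\,d_n^2)$ ([newton_sum_clear_le]). But $\lim g_n^{1/n}$ is at least $4$
    for $p = 2$ and at least $3^{3/2}$ for $p = 3$, while $d_n\le432^{n/5}<3.37^n$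
    along the powers of 6 ([lcm_upto_exp6]), by a variant of Chebyshev's argument. *)

(** * Least common multiples *)

Section LcmUpto.
Local Open Scope nat_scope.

Definition lcm_upto (n : nat) : nat := \big[lcmn/1]_(i < n) i.+1.

Lemma dvdn_lcm_upto n i : 0 < i <= n -> i %| lcm_upto n.
Proof.
case/andP=> i0 le_in; have lt_in : i.-1 < n by rewrite prednK.
by apply: (@biglcmn_sup _ (Ordinal lt_in)) => //=; rewrite prednK.
Qed.

Lemma lcm_upto_gt0 n : 0 < lcm_upto n.
Proof.
by rewrite /lcm_upto; elim/big_ind: _ => // a b; rewrite lcmn_gt0 => -> ->.
Qed.

Definition trinomial m := 'C(6 * m, 3 * m) * 'C(3 * m, m).

Lemma trinomial_gt0 m : 0 < trinomial m.
Proof. by rewrite muln_gt0 !bin_gt0; lia. Qed.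

Lemma trinomial_fact m :
  trinomial m * ((3 * m)`! * ((2 * m)`! * m`!)) = (6 * m)`!.
Proof.
have h1 : 3 * m <= 6 * m by lia.
have h2 : m <= 3 * m by lia.
have := bin_fact h1; have := bin_fact h2.
have -> : 6 * m - 3 * m = 3 * m by lia.
have -> : 3 * m - m = 2 * m by lia.
by rewrite /trinomial => e2 <-; rewrite -e2; ring.
Qed.

(** Both binomial coefficients are terms of a binomial expansion, of
    $(1+1)^{6m}$ and of $(2+1)^{3m}$. *)
Lemma trinomial_le m : trinomial m <= 432 ^ m.
Proof.
have term (a b n i : nat) : i <= n -> 'C(n, i) * (a ^ (n - i) * b ^ i) <= (a + b) ^ n.
  move=> le_in; rewrite expnDn (bigD1 (inord i : 'I_n.+1)) //= inordK ?ltnS//.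
  exact: leq_addr.
have h1 : 3 * m <= 6 * m by lia.
have h2 : m <= 3 * m by lia.
have := term 1 1 _ _ h1; rewrite !exp1n !muln1 expnM => b1.
have := term 2 1 _ _ h2; rewrite exp1n muln1 expnM => b2.
have e2 : 3 * m - m = 2 * m by lia.
rewrite e2 expnM in b2.
rewrite -(@leq_pmul2r (4 ^ m)) ?expn_gt0// /trinomial -mulnA.
apply: (leq_trans (leq_mul b1 b2)).
by rewrite -!expnMn; apply: eq_leq; congr (_ ^ m).
Qed.

Lemma logn_fact_upto q n N :
  prime q -> n <= N -> logn q n`! = \sum_(1 <= k < N.+1) n %/ q ^ k.
Proof.
move=> q_pr le_nN; rewrite logn_fact// (@big_cat_nat _ _ _ n.+1 1 N.+1) //=.
rewrite [X in _ + X]big_nat_cond [X in _ + X]big1 ?addn0// => k.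
rewrite andbT => /andP[lt_nk _]; rewrite divn_small//.
by apply: (leq_trans lt_nk); rewrite ltnW// ltn_expl// prime_gt1.
Qed.

Lemma divn_6321 m d : 0 < d ->
  (3 * m) %/ d + (2 * m) %/ d + m %/ d + (m < d <= 6 * m) <= (6 * m) %/ d.
Proof.
move=> d0.
have := divn_eq (3 * m) d; have := ltn_pmod (3 * m) d0.
have := divn_eq (2 * m) d; have := ltn_pmod (2 * m) d0.
have := divn_eq m d; have := ltn_pmod m d0.
have := divn_eq (6 * m) d; have := ltn_pmod (6 * m) d0.
move: (6 * m %/ d) (6 * m %% d) (m %/ d) (m %% d) => a6 r6 a1 r1 l6 e6 l1 e1.
move: (2 * m %/ d) (2 * m %% d) (3 * m %/ d) (3 * m %% d) => a2 r2 a3 r3 l2 e2 l3 e3.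
case: (boolP (m < d <= 6 * m)) => [/andP[md d6]|_] /=; last first.
  by rewrite addn0 -ltnS -(ltn_pmul2r d0) mulSn !mulnDl; lia.
have lt_of k a r : 0 < k -> k * m = a * d + r -> a < k.
  by move=> k0 e; rewrite -(ltn_pmul2r d0); nia.
have := lt_of 3 _ _ isT e3; have := lt_of 2 _ _ isT e2.
have := lt_of 1 _ _ isT (etrans (mul1n m) e1).
case: a1 e1 => [|a1]; last by lia.
case: a2 e2 => [|[|a2]] e2 e1 _; last by lia.
all: case: a3 e3 => [|[|[|a3]]] e3 _; try lia.
all: by case: a6 e6 => [|[|[|[|a6]]]] e6 _; lia.
Qed.

(** A prime power $q^k$ with $m < q^k \le 6m$ contributes to
    the exponent of $q$ in the multinomial coefficient
    $(6m)!/((3m)!\,(2m)!\,m!)$. *)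
Lemma logn_trinomial q m : prime q -> 0 < m ->
  trunc_log q (6 * m) <= trunc_log q m + logn q (trinomial m).
Proof.
move=> q_pr m0; have q1 := prime_gt1 q_pr.
move: (trinomial m) (trinomial_gt0 m) (trinomial_fact m) => M M0.
move=> /(congr1 (logn q)); rewrite !lognM ?muln_gt0 ?fact_gt0//.
rewrite !(@logn_fact_upto _ _ (6 * m)) //; try lia.
have sub : \sum_(1 <= k < (6 * m).+1) ((3 * m) %/ q ^ k + (2 * m) %/ q ^ k +
    m %/ q ^ k + (m < q ^ k <= 6 * m)) <= \sum_(1 <= k < (6 * m).+1) (6 * m) %/ q ^ k.
  by apply: leq_sum => k _; apply: divn_6321; rewrite expn_gt0 prime_gt0.
rewrite !big_split /= in sub.
suff : trunc_log q (6 * m) - trunc_log q m <=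
    \sum_(1 <= k < (6 * m).+1) (m < q ^ k <= 6 * m).
  by move: sub; lia.
have le_t : trunc_log q (6 * m) <= 6 * m.
  apply: leq_trans (ltnW (ltn_expl _ q1)) _; apply: trunc_logP => //; lia.
set a := trunc_log q m; set b := trunc_log q (6 * m).
case: (leqP b a) => [|ltab]; first by lia.
rewrite (@big_cat_nat _ _ _ a.+1 1) //=; last by lia.
rewrite (@big_cat_nat _ _ _ b.+1 a.+1) //=; try lia.
rewrite addnCA; apply: leq_trans (leq_addr _ _).
have -> : b - a = \sum_(a.+1 <= k < b.+1) 1 by rewrite sum_nat_const_nat; lia.
rewrite big_nat_cond [X in _ <= X]big_nat_cond; apply: leq_sum => k.
rewrite andbT => /andP[ak kb].
suff -> : m < q ^ k <= 6 * m by [].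
apply/andP; split.
  by apply: leq_trans (trunc_log_ltn m q1) _; rewrite leq_exp2l.
apply: leq_trans (_ : q ^ b <= _); first by rewrite leq_exp2l.
by apply: trunc_logP => //; lia.
Qed.

Lemma lcm_upto_step m : 0 < m -> lcm_upto (6 * m) %| lcm_upto m * trinomial m.
Proof.
move=> m0; apply/dvdn_biglcmP => i _; apply/dvdn_partP => // q qi.
have q_pr : prime q by move: qi; rewrite mem_primes => /and3P[].
have q1 := prime_gt1 q_pr; have := logn_trinomial q_pr m0.
have := lcm_upto_gt0 m; have := trinomial_gt0 m.
move: (trinomial m) => M M0 d0 le_log.
rewrite p_part pfactor_dvdn ?muln_gt0 ?M0 ?d0// lognM//.
have le1 : logn q i.+1 <= trunc_log q (6 * m).
  rewrite -ltnS -(ltn_exp2l _ _ q1); apply: leq_ltn_trans (trunc_log_ltn _ q1).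
  by apply: leq_trans (ltn_ord i); apply: dvdn_leq => //; exact: pfactor_dvdnn.
have le2 : trunc_log q m <= logn q (lcm_upto m).
  rewrite -pfactor_dvdn ?lcm_upto_gt0//; apply: dvdn_lcm_upto.
  by rewrite expn_gt0 prime_gt0//= trunc_logP.
by apply: (leq_trans le1); apply: (leq_trans le_log); rewrite leq_add2r.
Qed.

(** The bound $d_{6m} \le 432^m d_m$ is iterated along powers of 6, where it
    loses nothing: $d_n \le 432^{n/5}$, and $432^{1/5} < 3.37$. *)
Lemma lcm_upto_exp6 j : lcm_upto (6 ^ j) ^ 5 <= 432 ^ (6 ^ j).
Proof.
elim: j => [|j IHj]; first by rewrite expn0 /lcm_upto big_ord1.
rewrite (expnS 6); set m := 6 ^ j in IHj *; have m0 : 0 < m by rewrite expn_gt0.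
have le1 : lcm_upto (6 * m) <= lcm_upto m * 432 ^ m.
  apply: leq_trans (dvdn_leq _ (lcm_upto_step m0)) _.
    by rewrite muln_gt0 lcm_upto_gt0 trinomial_gt0.
  by rewrite leq_mul2l trinomial_le orbT.
move: le1; rewrite -(@leq_exp2r (lcm_upto (6 * m)) _ 5)// expnMn => le5.
apply: (leq_trans le5).
have -> : 432 ^ (6 * m) = 432 ^ m * (432 ^ m) ^ 5.
  by rewrite -expnM -expnD; congr (_ ^ _); lia.
by rewrite leq_mul2r IHj orbT.
Qed.

End LcmUpto.

(** * Binomial transforms and an Apery-like recurrence *)

Section BinomialTransform.
Variable R : comNzRingType.
Implicit Types c d : nat -> R.

Definition binom_transform c n : R := \sum_(k < n.+1) c k *+ 'C(n, k).

Lemma binom_transform0 c : binom_transform c 0 = c 0%N.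
Proof. by rewrite /binom_transform big_ord1 bin0 mulr1n. Qed.

Lemma eq_binom_transform c d : c =1 d -> binom_transform c =1 binom_transform d.
Proof. by move=> cd n; apply: eq_bigr => k _; rewrite cd. Qed.

Lemma binom_transformD c d n :
  binom_transform (fun k => c k + d k) n = binom_transform c n + binom_transform d n.
Proof. by rewrite -big_split; apply: eq_bigr => k _; rewrite mulrnDl. Qed.

Lemma binom_transformZ a c n :
  binom_transform (fun k => a * c k) n = a * binom_transform c n.
Proof. by rewrite /binom_transform big_distrr /=; apply: eq_bigr => k _; rewrite mulrnAr. Qed.

Lemma binom_transformS c n :
  binom_transform c n.+1 =
  binom_transform c n + binom_transform (fun k => c k.+1) n.
Proof.
rewrite /binom_transform big_ord_recl /= bin0 [X in _ = X + _]big_ord_recl /= bin0.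
under eq_bigr do rewrite /bump /= add1n binS mulrnDr.
rewrite big_split /= addrA; congr (_ + _ + _).
by rewrite big_ord_recr /= bin_small// mulr0n addr0.
Qed.

Lemma binom_transform_absorb c n :
  binom_transform (fun k => k%:R * c k) n.+1 =
  n.+1%:R * binom_transform (fun k => c k.+1) n.
Proof.
rewrite /binom_transform big_ord_recl /= mul0r mul0rn add0r big_distrr /=.
apply: eq_bigr => k _; rewrite /bump /= add1n.
rewrite -mulrnAr -!(mulr_natl (c k.+1)).
by rewrite !mulrA -!natrM mul_bin_diag mulnC.
Qed.

Lemma binom_transform_sign n :
  binom_transform (fun k => (-1) ^+ k) n = (n == 0)%:R.
Proof.
case: n => [|n]; first by rewrite binom_transform0.
rewrite binom_transformS -binom_transformD /binom_transform big1// => k _.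
by rewrite exprS mulN1r subrr mul0rn.
Qed.

End BinomialTransform.

Section AperyRecurrence.
Variable R : comNzRingType.
Variables (y eps : R) (c : nat -> R).
Hypothesis c_rec :
  forall k, k.+1%:R ^+ 2 * c k.+1 = (y - k%:R ^+ 2) * c k + eps * (-1) ^+ k.

Local Notation u := (binom_transform c).

(** By Pascal's rule, the weight $k^2$ turns the first order recurrence for $c$
    into an equation for the transform in which the two sums with $k^2 c_k$
    cancel. *)
Lemma binom_transform_sqr n :
  binom_transform (fun k => k%:R * (k%:R * c k)) n.+1 = y * u n + eps * (n == 0)%:R.
Proof.
rewrite binom_transformS.
rewrite (@eq_binom_transform _ (fun k => k.+1%:R * (k.+1%:R * c k.+1))
  (fun k => (y * c k + (-1) * (k%:R * (k%:R * c k))) + eps * (-1) ^+ k)); last first.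
  by move=> k; rewrite mulrA -expr2 c_rec mulrBl expr2 mulN1r !mulrA.
by rewrite !binom_transformD !binom_transformZ binom_transform_sign; ring.
Qed.

Lemma apery_rec0 : u 1%N - u 0%N = y * u 0%N + eps.
Proof.
have := binom_transform_sqr 0; rewrite binom_transform_absorb mul1r mulr1.
rewrite binom_transformS => <-; rewrite addrAC subrr add0r !binom_transform0.
by rewrite mul1r.
Qed.

Lemma apery_rec n :
  n.+2%:R * (n.+2%:R * (u n.+2 - u n.+1) - n.+1%:R * (u n.+1 - u n)) = y * u n.+1.
Proof.
have := binom_transform_sqr n.+1; rewrite mulr0 addr0 => <-.
rewrite binom_transform_absorb; congr (_ * _).
have diff m : u m.+1 - u m = binom_transform (fun k => c k.+1) m.
  by rewrite binom_transformS addrAC subrr add0r.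
rewrite !diff -!binom_transform_absorb binom_transformS.
by rewrite addrAC subrr add0r.
Qed.

End AperyRecurrence.

(** As for every second order linear recurrence, the Casoratian of two solutions
    satisfies a first order one, here $(n+2)W_{n+1} = (n+1)W_n$. *)
Lemma casoratian (F : numFieldType) (y eps : F) (a b : nat -> F) :
  (forall k, k.+1%:R ^+ 2 * a k.+1 = (y - k%:R ^+ 2) * a k) ->
  (forall k, k.+1%:R ^+ 2 * b k.+1 = (y - k%:R ^+ 2) * b k + eps * (-1) ^+ k) ->
  let u := binom_transform a in let v := binom_transform b in
  forall n, v n.+1 * u n - v n * u n.+1 = a 0%N * eps / n.+1%:R.
Proof.
move=> a_rec b_rec u v.
have a_rec' k : k.+1%:R ^+ 2 * a k.+1 = (y - k%:R ^+ 2) * a k + 0 * (-1) ^+ k.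
  by rewrite mul0r addr0.
elim=> [|n IHn].
  have := apery_rec0 a_rec'; have := apery_rec0 b_rec; rewrite -/u -/v divr1.
  have -> : u 0%N = a 0%N by rewrite /u binom_transform0.
  move=> /(canRL (subrK _)) -> /(canRL (subrK _)) ->; ring.
have := apery_rec a_rec' n; have := apery_rec b_rec n; rewrite -/u -/v.
set m := n.+2%:R; set l := n.+1%:R => hv hu.
have m0 : m != 0 by rewrite pnatr_eq0.
have l0 : l != 0 by rewrite pnatr_eq0.
apply: (mulfI m0); apply: (mulfI m0).
transitivity (m * l * (v n.+1 * u n - v n * u n.+1)); last first.
  by rewrite IHn -/l -/m; clearbody m l; field; rewrite m0 l0.
have hv' : m * (m * (v n.+2 - v n.+1)) = m * (l * (v n.+1 - v n)) + y * v n.+1.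
  by rewrite -hv; ring.
have hu' : m * (m * (u n.+2 - u n.+1)) = m * (l * (u n.+1 - u n)) + y * u n.+1.
  by rewrite -hu; ring.
transitivity ((m * (m * (v n.+2 - v n.+1))) * u n.+1
  - v n.+1 * (m * (m * (u n.+2 - u n.+1)))); first by ring.
by rewrite hv' hu'; ring.
Qed.

(** The differences $\delta_n = u_{n+1}-u_n$ satisfy
    $(n+1)\delta_n = n\delta_{n-1} + y u_n/(n+1)$, so that the slow growth of $u$
    keeps $\delta$ bounded. *)
Lemma apery_bound (F : realFieldType) (y eps : F) (c : nat -> F) :
  (forall k, k.+1%:R ^+ 2 * c k.+1 = (y - k%:R ^+ 2) * c k + eps * (-1) ^+ k) ->
  0 <= y <= 1 -> 0 <= c 0%N <= 1 -> 0 <= y * c 0%N + eps <= 1 ->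
  forall n, 0 <= binom_transform c n <= n.+1%:R.
Proof.
move=> c_rec /andP[y0 y1] /andP[c00 c01] /andP[d0 d1] n.
set u := binom_transform c.
have u0 : u 0%N = c 0%N by rewrite /u binom_transform0.
have := apery_rec0 c_rec; have := apery_rec c_rec; rewrite -/u => rec rec0.
suff : (0 <= u n <= n.+1%:R) && (0 <= u n.+1 - u n <= 1) by case/andP.
elim: n => [|n]; first by rewrite rec0 u0 c00 c01 d0 d1.
move: (rec n) => {}rec /andP[/andP[un0 unn] /andP[dn0 dn1]].
have e1 : n.+2%:R = n.+1%:R + 1 :> F by rewrite -(natrD _ n.+1 1) addn1.
have uS0 : 0 <= u n.+1 by lra.
have uSn : u n.+1 <= n.+2%:R by rewrite e1; lra.
rewrite uS0 uSn /=.
have m0 : 0 < n.+2%:R :> F by rewrite ltr0n.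
have l0 : 0 <= n.+1%:R :> F by rewrite ler0n.
have e2 : n.+2%:R * (u n.+2 - u n.+1) = n.+1%:R * (u n.+1 - u n) + y * u n.+1 / n.+2%:R.
  by rewrite -rec [_ / _]mulrC mulKf ?gt_eqF//; ring.
have q0 : 0 <= y * u n.+1 / n.+2%:R.
  by rewrite divr_ge0 ?mulr_ge0// ltW.
have q1 : y * u n.+1 / n.+2%:R <= 1.
  rewrite ler_pdivrMr// mul1r; apply: le_trans uSn; exact: ler_piMl.
rewrite -(pmulr_rge0 _ m0) e2 addr_ge0 ?q0// ?mulr_ge0//=.
by rewrite -(ler_pM2l m0) e2 mulr1 [leRHS]e1; apply: lerD => //; exact: ler_piMr.
Qed.

(** * The rational approximations and their denominators *)

Section Approximants.
Variable y : rat.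
Implicit Types (i k n : nat).

Definition node_prod k : rat := \prod_(j < k) (y - j%:R ^+ 2).

(** The polynomials $\binom{x}{k}\binom{x+k-1}{k}$ in $x$, where $y = x^2$. *)
Definition node_term k : rat := node_prod k / k`!%:R ^+ 2.

(** The terms of the Newton series, at the nodes $y = j^2$, of
    $-\sum_j G_{2j+2}\,y^{-j-1}$, where $G_j$ are the Genocchi numbers. *)
Definition newton_term i : rat := (-1) ^+ i * i`!%:R ^+ 2 / node_prod i.+1.

Definition newton_sum k : rat := \sum_(i < k) newton_term i.

(** The continuous dual Hahn polynomials
    $Q_n(x) = \sum_k\binom nk\binom xk\binom{x+k-1}k$, which are orthogonal for these
    moments: [approx_num]/[approx_den] is the $n$-th Stieltjes convergent. *)
Definition approx_den : nat -> rat := binom_transform node_term.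

Definition approx_num : nat -> rat :=
  binom_transform (fun k => node_term k * newton_sum k).

Lemma node_prodS k : node_prod k.+1 = node_prod k * (y - k%:R ^+ 2).
Proof. by rewrite /node_prod big_ord_recr. Qed.

Lemma factr_neq0 (F : numFieldType) k : k`!%:R != 0 :> F.
Proof. by rewrite pnatr_eq0 -lt0n fact_gt0. Qed.

Lemma factrS (F : numFieldType) k : k.+1`!%:R = k.+1%:R * k`!%:R :> F.
Proof. by rewrite factS natrM. Qed.

Lemma node_term_rec k :
  k.+1%:R ^+ 2 * node_term k.+1 = (y - k%:R ^+ 2) * node_term k.
Proof.
rewrite /node_term node_prodS factS natrM.
have := factr_neq0 rat k; have : k.+1%:R != 0 :> rat by rewrite pnatr_eq0.
by move: (k.+1%:R) (k`!%:R) => a b a0 b0; field; rewrite a0 b0.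
Qed.

Hypothesis y_node : forall j, y - j%:R ^+ 2 != 0.

Lemma node_prod_neq0 k : node_prod k != 0.
Proof. by apply/prodf_neq0 => j _. Qed.

(** The factors $k!^2$ of the Newton terms are such that multiplication by the
    partial sums perturbs the recurrence only by a sign, which the binomial transform
    annihilates beyond $n = 0$: numerators and denominators satisfy one recurrence. *)
Lemma node_term_sum_rec k :
  k.+1%:R ^+ 2 * (node_term k.+1 * newton_sum k.+1) =
  (y - k%:R ^+ 2) * (node_term k * newton_sum k) + 1 * (-1) ^+ k.
Proof.
rewrite mulrA node_term_rec /newton_sum big_ord_recr /= mulrDr -!mulrA.
congr (_ + _); rewrite /newton_term /node_term node_prodS mul1r.
have := factr_neq0 rat k; have := node_prod_neq0 k; have := y_node k.
by move: (y - _) (node_prod k) (k`!%:R) => a b c a0 b0 c0; field; rewrite a0 b0.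
Qed.

Lemma approx_casoratian n :
  approx_num n.+1 * approx_den n - approx_num n * approx_den n.+1 = n.+1%:R^-1.
Proof.
rewrite (casoratian node_term_rec node_term_sum_rec) /node_term.
by rewrite /node_prod big_ord0 fact0 expr1n divr1 mulr1 div1r.
Qed.

Lemma approx_bounds n : 0 <= y <= 1 ->
  (0 <= approx_den n <= n.+1%:R) && (0 <= approx_num n <= n.+1%:R).
Proof.
move=> y01; have e0 : node_term 0 = 1.
  by rewrite /node_term /node_prod big_ord0 fact0 expr1n divr1.
apply/andP; split.
  apply: (@apery_bound _ y 0) => //; rewrite ?e0 ?mulr1 ?addr0 ?lexx ?ler01//.
  by move=> k; rewrite mul0r addr0 node_term_rec.
apply: (apery_bound node_term_sum_rec) => //.
all: by rewrite /newton_sum big_ord0 !mulr0 ?add0r lexx ler01.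
Qed.

End Approximants.

Section Denominators.

Definition rising (z : rat) m : rat := \prod_(l < m) (z + l%:R).

Lemma rising_nat (N m : nat) : (\prod_(l < m) (N.+1 + l) = m`! * 'C(N + m, m))%N.
Proof.
elim: m => [|m IHm]; first by rewrite big_ord0 bin0.
rewrite big_ord_recr /= IHm addnS addSn -mulnA [('C(_, _) * _)%N]mulnC.
by rewrite mul_bin_diag factS mulnA [(_ * m.+1)%N]mulnC.
Qed.

Lemma eqz_mod_prod (d : int) m (f g : nat -> int) :
  (forall l, (f l = g l %[mod d])%Z) ->
  (\prod_(l < m) f l = \prod_(l < m) g l %[mod d])%Z.
Proof.
move=> fg; apply: (big_ind2 (fun a b => (a = b %[mod d])%Z)) => //.
by move=> a1 a2 b1 b2 e1 e2; rewrite -modzMm e1 e2 modzMm.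
Qed.

Lemma dvdz_fact_rising (z : int) m : (m`!%:Z %| \prod_(l < m) (z + l%:Z))%Z.
Proof.
have d0 : m`!%:Z != 0 by rewrite -lt0n fact_gt0.
set N := `|((z - 1) %% m`!)%Z|%N.
have eN : N%:Z = ((z - 1) %% m`!)%Z by rewrite gez0_abs// modz_ge0.
apply/dvdz_mod0P; rewrite (@eqz_mod_prod _ _ (fun l => z + l%:Z) (fun l => (N.+1 + l)%:Z)).
  rewrite -(big_morph Posz PoszM (erefl _)) rising_nat PoszM.
  by apply/dvdz_mod0P/dvdz_mulr.
move=> l; rewrite PoszD -addn1 PoszD eN -addrA modzDml.
by congr (_ %% _)%Z; ring.
Qed.

(** Modulo an integer prime to the step, an arithmetic progression is a multiple
    of a run of consecutive integers. *)
Lemma dvdz_progression (b c : int) (d m : nat) :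
  (d %| m`!)%N -> coprimez d%:Z c -> (d%:Z %| \prod_(l < m) (b + l%:Z * c))%Z.
Proof.
move=> d_fact /coprimezP[[u v] /= uv].
have dv : coprimez d%:Z (v ^+ m).
  apply: coprimezXr; apply/coprimezP; exists (u, c) => /=.
  by rewrite -uv [c * v]mulrC.
rewrite -(Gauss_dvdzr _ dv).
have -> : v ^+ m = \prod_(l < m) v by rewrite prodr_const card_ord.
rewrite -big_split /=; apply/dvdz_mod0P.
rewrite (@eqz_mod_prod _ _ (fun l => v * (b + l%:Z * c)) (fun l => v * b + l%:Z)); last first.
  move=> l; apply/eqP; rewrite eqz_mod_dvd; apply/dvdzP; exists (- l%:Z * u).
  have e : u * d%:Z = 1 - v * c by rewrite -uv addrK.
  by rewrite -mulrA e; ring.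
by apply/dvdz_mod0P/(dvdz_trans _ (dvdz_fact_rising _ _)).
Qed.

(** The $p$-part of the common denominator of the $\binom{b/p^r}{m}$ with
    $m \le n$. *)
Definition binom_clear (p r n : nat) : nat := (p ^ (r * n + logn p n`!))%N.

Lemma rising_clear p r n m (b : int) : prime p -> (m <= n)%N ->
  (binom_clear p r n)%:R * (rising (b%:~R / (p ^ r)%:R) m / m`!%:R) \is a Num.int.
Proof.
move=> p_pr le_mn; set F := (p ^ r)%N.
have F0 : F%:R != 0 :> rat by rewrite pnatr_eq0 -lt0n expn_gt0 prime_gt0.
have p0 : p%:R != 0 :> rat by rewrite pnatr_eq0 -lt0n prime_gt0.
pose d := (m`!`_p^')%N.
have d0 : d%:R != 0 :> rat by rewrite pnatr_eq0 -lt0n part_gt0.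
have e_fact : m`! = (p ^ logn p m`! * d)%N by rewrite -p_part partnC// fact_gt0.
have dF : coprimez d%:Z F%:Z.
  rewrite coprimezE /= coprimeXr//.
  by rewrite coprime_sym prime_coprime// -p'natE// part_pnat.
have /dvdzP[t et] : (d%:Z %| \prod_(l < m) (b + l%:Z * F%:Z))%Z.
  by apply: dvdz_progression => //; rewrite e_fact dvdn_mull.
have -> : rising (b%:~R / F%:R) m = (t * d%:Z)%:~R / F%:R ^+ m.
  rewrite -et /rising rmorph_prod /= -[X in _ / F%:R ^+ X](card_ord m).
  rewrite -prodr_const -prodf_div; apply: eq_bigr => l _.
  by rewrite rmorphD rmorphM /= mulrDl mulfK.
have le_v : (logn p m`! <= logn p n`!)%N.
  apply: dvdn_leq_log; rewrite ?fact_gt0//.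
  by rewrite -(bin_fact le_mn) dvdn_mull// dvdn_mulr.
rewrite e_fact /binom_clear -/F.
have -> : (r * n + logn p n`!)%N =
    (r * (n - m) + (logn p n`! - logn p m`!) + (r * m + logn p m`!))%N by nia.
set a := logn p m`!.
have -> : (p ^ (r * (n - m) + (logn p n`! - a) + (r * m + a)))%:R *
   ((t * d%:Z)%:~R / F%:R ^+ m / (p ^ a * d)%:R) =
   (p ^ (r * (n - m) + (logn p n`! - a)))%:R * t%:~R :> rat.
  rewrite intrM -pmulrn !expnD !natrM /F -natrX -expnM.
  have : (p ^ (r * m))%:R != 0 :> rat by rewrite natrX expf_neq0.
  have : (p ^ a)%:R != 0 :> rat by rewrite natrX expf_neq0.
  move: ((p ^ a)%:R) ((p ^ (r * m))%:R) (d%:R) d0 => A B C C0 A0 B0.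
  by field; rewrite A0 B0 C0.
by rewrite rpredM// ?natr_int// intr_int.
Qed.



(** The quotient is $\int_0^1 t^i(1-t)^m\,dt$, an integral combination of the
    $1/(i+1+j)$ with $j \le m$; the induction splits one factor $1-t$ off. *)
Lemma beta_clear n i m : (i + m < n)%N ->
  (lcm_upto n)%:R * (i`!%:R * m`!%:R / (i + m).+1`!%:R) \is a @Num.int rat.
Proof.
elim: m i => [|m IHm] i lt_n.
  have /dvdnP[t ->] : (i.+1 %| lcm_upto n)%N by rewrite dvdn_lcm_upto// -(addn0 i).
  rewrite addn0 factrS natrM fact0 mulr1.
  have -> : t%:R * i.+1%:R * (i`!%:R / (i.+1%:R * i`!%:R)) = t%:R :> rat.
    have : i.+1%:R != 0 :> rat by rewrite pnatr_eq0.
    have := factr_neq0 rat i; move: (i.+1%:R) (i`!%:R) => a b b0 a0.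
    by field; rewrite a0 b0.
  exact: natr_int.
have -> : i`!%:R * m.+1`!%:R / (i + m.+1).+1`!%:R =
  i`!%:R * m`!%:R / (i + m).+1`!%:R
  - i.+1`!%:R * m`!%:R / (i.+1 + m).+1`!%:R :> rat.
  rewrite addnS addSn (factrS _ (i + m).+1) (factrS _ m) (factrS _ i).
  have -> : (i + m).+2%:R = i.+1%:R + m.+1%:R :> rat by rewrite -natrD addnS.
  have E (a b c d e : rat) : e != 0 -> a + b != 0 ->
      c * (b * d) / ((a + b) * e) = c * d / e - a * c * d / ((a + b) * e).
    by move=> e0 ab0; field; rewrite e0 ab0.
  by apply: E; [exact: factr_neq0 | rewrite -natrD pnatr_eq0].
by rewrite mulrBr rpredB//; apply: IHm; lia.
Qed.

Lemma node_prod_rising x k :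
  node_prod (x ^+ 2) k = (-1) ^+ k * (rising x k * rising (- x) k).
Proof.
rewrite /rising /node_prod -big_split /= -[X in (-1) ^+ X](card_ord k) -prodr_const.
by rewrite -big_split; apply: eq_bigr => l _ /=; ring.
Qed.

Lemma node_prod_tail y i m :
  node_prod y (i.+1 + m) =
  node_prod y i.+1 * \prod_(l < m) (y - (i.+1 + l)%:R ^+ 2).
Proof. by rewrite /node_prod big_split_ord. Qed.

Lemma tail_rising x i m :
  \prod_(l < m) (x ^+ 2 - (i.+1 + l)%:R ^+ 2) =
  (-1) ^+ m * (rising (x + i.+1%:R) m * rising (- x + i.+1%:R) m).
Proof.
rewrite /rising -big_split /= -[X in (-1) ^+ X](card_ord m) -prodr_const.
by rewrite -big_split; apply: eq_bigr => l _ /=; rewrite natrD; ring.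
Qed.

Section Clearing.
Variables (p r : nat) (b : int).
Hypothesis p_pr : prime p.
Let x : rat := b%:~R / (p ^ r)%:R.
Let y := x ^+ 2.

Let F0 : (p ^ r)%:R != 0 :> rat.
Proof. by rewrite pnatr_eq0 -lt0n expn_gt0 prime_gt0. Qed.

Lemma rising_shift_clear n m (s : bool) (i : nat) : (m <= n)%N ->
  (binom_clear p r n)%:R * (rising ((-1) ^+ s * x + i%:R) m / m`!%:R) \is a Num.int.
Proof.
move=> le_mn.
have -> : (-1) ^+ s * x + i%:R = ((-1) ^+ s * b + i%:Z * (p ^ r)%:Z)%:~R / (p ^ r)%:R.
  by rewrite rmorphD !rmorphM rmorphXn rmorphN1 /= mulrDl mulfK// mulrA.
exact: rising_clear.
Qed.

Definition approx_clear n : nat := (lcm_upto n * binom_clear p r n) ^ 2.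

Lemma node_term_clear n k : (k <= n)%N ->
  (binom_clear p r n)%:R ^+ 2 * node_term y k \is a Num.int.
Proof.
move=> le_kn; rewrite /node_term node_prod_rising.
have := @rising_shift_clear n k false 0 le_kn.
have := @rising_shift_clear n k true 0 le_kn.
rewrite expr1 expr0 mulN1r mul1r !addr0 => h1 h2.
have -> : (binom_clear p r n)%:R ^+ 2 *
    ((-1) ^+ k * (rising x k * rising (- x) k) / k`!%:R ^+ 2) =
  (-1) ^+ k * (((binom_clear p r n)%:R * (rising x k / k`!%:R)) *
     ((binom_clear p r n)%:R * (rising (- x) k / k`!%:R))).
  by have := factr_neq0 rat k; move: (k`!%:R) => a a0; field.
by rewrite rpredMsign rpredM.
Qed.

Lemma approx_den_clear n : (approx_clear n)%:R * approx_den y n \is a Num.int.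
Proof.
rewrite /approx_clear natrX natrM exprMn -mulrA rpredM ?rpredX ?natr_int//.
rewrite /approx_den /binom_transform big_distrr rpred_sum//= => k _.
by rewrite mulrnAr rpredMn// node_term_clear// -ltnS.
Qed.

(** The product is $\pm(i!^2/k!^2)\prod_{i<j<k}(x^2-j^2)$. With $m = k-i-1$ it is the
    square of the beta value $i!\,m!/k!$, cleared by $d_n^2$, times two binomial
    coefficients $\prod(x\pm j)/m!$. *)
Lemma term_mul_clear n k i : (forall j, y - j%:R ^+ 2 != 0) ->
  (i < k <= n)%N ->
  (approx_clear n)%:R * (node_term y k * newton_term y i) \is a Num.int.
Proof.
move=> y_node /andP[lt_ik le_kn].
have /subnKC ek := lt_ik; set m := (k - i.+1)%N in ek.
have le_mn : (m <= n)%N by apply: leq_trans le_kn; rewrite leq_subr.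
have := @rising_shift_clear n m false i.+1 le_mn.
have := @rising_shift_clear n m true i.+1 le_mn.
rewrite expr1 expr0 mulN1r mul1r => h1 h2.
have h3 : (lcm_upto n)%:R * (i`!%:R * m`!%:R / k`!%:R) \is a @Num.int rat.
  by rewrite -ek addSn beta_clear// -addSn ek.
rewrite /node_term /newton_term -[in node_prod _ k]ek node_prod_tail tail_rising.
rewrite /approx_clear natrX natrM.
have E (w a c e g D s t rm rp : rat) : w != 0 -> a != 0 -> c != 0 ->
    (g * D) ^+ 2 * (w * (s * (rp * rm)) / a ^+ 2 * (t * e ^+ 2 / w)) =
    s * (t * ((D * (rm / c)) * (D * (rp / c)) * (g * (e * c / a)) ^+ 2)).
  by move=> w0 a0 c0; field; rewrite a0 c0 w0.
rewrite (E _ _ m`!%:R) ?factr_neq0 ?node_prod_neq0//.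
by rewrite !rpredMsign rpredM ?rpredX// rpredM.
Qed.

Lemma approx_num_clear n : (forall j, y - j%:R ^+ 2 != 0) ->
  (approx_clear n)%:R * approx_num y n \is a Num.int.
Proof.
move=> y_node; rewrite /approx_num /binom_transform big_distrr rpred_sum//= => k _.
rewrite mulrnAr rpredMn// /newton_sum big_distrr big_distrr rpred_sum//= => i _.
by rewrite term_mul_clear// ltn_ord -ltnS ltn_ord.
Qed.

End Clearing.
End Denominators.

(** * The p-adic absolute value on the rationals *)

Section PadicNorm.
Variables (p : nat) (pp : prime p).
Local Notation Zp := (padic_int pp).
Local Notation Qp := (padic pp).
Local Notation norm := (@padic_norm p pp).

Lemma padic_norm1 : norm 1 = 1.
Proof.
apply: (mulIf (_ : norm 1 != 0)); first by rewrite padic_norm_eq0 oner_eq0.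
by rewrite -padic_normM !mul1r.
Qed.

Lemma padic_norm0 : norm 0 = 0.
Proof. by apply/eqP; rewrite padic_norm_eq0. Qed.

Lemma padic_normV x : norm x^-1 = (norm x)^-1.
Proof.
case: (eqVneq x 0) => [->|x0]; first by rewrite invr0 padic_norm0 invr0.
have nx0 : norm x != 0 by rewrite padic_norm_eq0.
by apply: (mulIf nx0); rewrite -padic_normM !mulVf// padic_norm1.
Qed.

Lemma padic_normX x n : norm (x ^+ n) = norm x ^+ n.
Proof.
elim: n => [|n IHn]; first by rewrite !expr0 padic_norm1.
by rewrite !exprS padic_normM IHn.
Qed.

Lemma padic_normD_le x y e : norm x <= e -> norm y <= e -> norm (x + y) <= e.
Proof. by move=> xe ye; apply: (le_trans (padic_normD _ _)); rewrite ge_max xe. Qed.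

Lemma padic_normD_lt x y e : norm x < e -> norm y < e -> norm (x + y) < e.
Proof. by move=> xe ye; apply: (le_lt_trans (padic_normD _ _)); rewrite gt_max xe. Qed.

Lemma padic_int_natE n k : (n%:R : Zp) k = (n%:Z %% (p ^ k)%:Z)%Z.
Proof.
elim: n => [|n IHn]; first by rewrite padic_int0E mod0z.
by rewrite -addn1 natrD padic_intDE IHn PoszD /= modzDm.
Qed.

Lemma padic_norm_nat n : (0 < n)%N -> norm n%:R = p%:R ^- logn p n.
Proof.
move=> n0; rewrite -[n%:R](rmorph_nat (@padic_of_int p pp)) padic_norm_int.
have en : (n%:R : Zp) n = n%:Z.
  by rewrite padic_int_natE modz_small// ltz_nat ltn_expl// prime_gt1.
have nz : (n%:R : Zp) n != 0 by rewrite en -lt0n.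
have nz' : (n%:R : Zp) != 0 by apply/padic_int_eq0P; exists n.
by rewrite /padic_int_norm (negbTE nz') (padic_int_val_logn nz) en.
Qed.

Lemma padic_natr_neq0 n : (0 < n)%N -> (n%:R : Qp) != 0.
Proof.
move=> n0; rewrite -padic_norm_eq0 padic_norm_nat// invr_neq0// expf_neq0//.
by rewrite pnatr_eq0 -lt0n prime_gt0.
Qed.

Lemma padic_intr_eq0 (z : int) : ((z%:~R : Qp) == 0) = (z == 0).
Proof.
have h n : ((n%:R : Qp) == 0) = (n == 0%N).
  by case: n => [|n]; [rewrite !eqxx | apply/negbTE/padic_natr_neq0].
by case: z => n; rewrite ?NegzE ?mulrNz ?oppr_eq0 -pmulrn h.
Qed.

(** A constant of its own, to which the ring morphism structure is attached. *)
Definition padic_of_rat : rat -> Qp := @ratr Qp.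

Lemma padic_of_rat_frac (a b : int) : b != 0 ->
  padic_of_rat (a%:~R / b%:~R) = a%:~R / b%:~R.
Proof.
move=> b0; set x : rat := _ / _; rewrite /padic_of_rat /ratr.
have d0 : denq x != 0 by [].
apply/eqP; rewrite eqr_div ?padic_intr_eq0// -!intrM; apply/eqP; congr (_%:~R).
apply: (@intr_inj rat); rewrite !intrM; apply/eqP.
by rewrite -eqr_div ?intr_eq0// divq_num_den.
Qed.

Fact padic_of_rat_is_zmod_morphism : zmod_morphism padic_of_rat.
Proof.
move=> x y; rewrite -[in LHS](divq_num_den x) -[in LHS](divq_num_den y).
rewrite -mulNr addf_div ?intr_eq0 ?denq_neq0// -mulrNz -!intrM -intrD.
rewrite padic_of_rat_frac ?mulf_neq0 ?denq_neq0// intrD !intrM mulrNz.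
by rewrite -addf_div ?padic_intr_eq0 ?denq_neq0// mulNr.
Qed.

Fact padic_of_rat_is_monoid_morphism : monoid_morphism padic_of_rat.
Proof.
split=> [|x y]; first by rewrite /padic_of_rat (ratr_nat _ 1).
rewrite -[in LHS](divq_num_den x) -[in LHS](divq_num_den y) mulf_div -!intrM.
by rewrite padic_of_rat_frac ?mulf_neq0 ?denq_neq0// !intrM -mulf_div.
Qed.

HB.instance Definition _ :=
  GRing.isZmodMorphism.Build rat Qp padic_of_rat padic_of_rat_is_zmod_morphism.
HB.instance Definition _ :=
  GRing.isMonoidMorphism.Build rat Qp padic_of_rat padic_of_rat_is_monoid_morphism.

Fact pabs_key : unit. Proof. by []. Qed.

(** Locked, lest the comparison of two absolute values unfold the fraction
    field. *)
Definition pabs : rat -> rat :=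
  locked_with pabs_key (fun q => norm (padic_of_rat q)).

Lemma pabsE q : pabs q = norm (padic_of_rat q).
Proof. by rewrite /pabs unlock. Qed.

Lemma pabs_ge0 q : 0 <= pabs q. Proof. by rewrite pabsE padic_norm_ge0. Qed.

Lemma pabs0 : pabs 0 = 0. Proof. by rewrite !pabsE rmorph0 padic_norm0. Qed.

Lemma pabs1 : pabs 1 = 1. Proof. by rewrite !pabsE rmorph1 padic_norm1. Qed.

Lemma pabs_eq0 q : (pabs q == 0) = (q == 0).
Proof. by rewrite !pabsE padic_norm_eq0 fmorph_eq0. Qed.

Lemma pabs_gt0 q : (0 < pabs q) = (q != 0).
Proof. by rewrite lt_def pabs_ge0 andbT pabs_eq0. Qed.

Lemma pabsM q s : pabs (q * s) = pabs q * pabs s.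
Proof. by rewrite !pabsE rmorphM padic_normM. Qed.

Lemma pabsX q n : pabs (q ^+ n) = pabs q ^+ n.
Proof. by rewrite !pabsE rmorphXn padic_normX. Qed.

Lemma pabsV q : pabs q^-1 = (pabs q)^-1.
Proof. by rewrite !pabsE fmorphV padic_normV. Qed.

Lemma pabsN q : pabs (- q) = pabs q.
Proof. by rewrite !pabsE rmorphN padic_normN. Qed.

Lemma pabs_sign n : pabs ((-1) ^+ n) = 1.
Proof. by rewrite pabsX pabsN pabs1 expr1n. Qed.

Lemma pabsB q s : pabs (q - s) = pabs (s - q).
Proof. by rewrite -opprB pabsN. Qed.

Lemma pabsD_le q s e : pabs q <= e -> pabs s <= e -> pabs (q + s) <= e.
Proof. by rewrite !pabsE rmorphD; apply: padic_normD_le. Qed.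

Lemma pabsD_lt q s e : pabs q < e -> pabs s < e -> pabs (q + s) < e.
Proof. by rewrite !pabsE rmorphD; apply: padic_normD_lt. Qed.

Lemma pabs_sum_le (I : Type) (r : seq I) (P : pred I) (f : I -> rat) e :
  0 <= e -> (forall i, P i -> pabs (f i) <= e) -> pabs (\sum_(i <- r | P i) f i) <= e.
Proof.
move=> e0 fe; elim/big_ind: _ => [|a b|i /fe//]; first by rewrite pabs0.
exact: pabsD_le.
Qed.

Lemma pabs_sum_lt (I : Type) (r : seq I) (P : pred I) (f : I -> rat) e :
  0 < e -> (forall i, P i -> pabs (f i) < e) -> pabs (\sum_(i <- r | P i) f i) < e.
Proof.
move=> e0 fe; elim/big_ind: _ => [|a b|i /fe//]; first by rewrite pabs0.
exact: pabsD_lt.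
Qed.

(** The isosceles triangle principle. *)
Lemma pabsD_dominant q s : pabs s < pabs q -> pabs (q + s) = pabs q.
Proof.
move=> sq; apply/eqP; rewrite eq_le pabsD_le ?(ltW sq)//= leNgt; apply/negP => lt.
have : pabs (q + s - s) < pabs q by apply: pabsD_lt; rewrite ?pabsN.
by rewrite addrK ltxx.
Qed.

Lemma pabs_nat n : (0 < n)%N -> pabs n%:R = p%:R ^- logn p n.
Proof. by move=> n0; rewrite pabsE rmorph_nat padic_norm_nat. Qed.

Let p0 : 0 < p%:R :> rat. Proof. by rewrite ltr0n prime_gt0. Qed.
Let p1 : 1 < p%:R :> rat. Proof. by rewrite ltr1n prime_gt1. Qed.

Lemma pabs_int_abs (z : int) : pabs z%:~R = pabs `|z|%N%:R.
Proof. by case: z => n; rewrite ?NegzE ?mulrNz ?pabsN -?pmulrn ?abszN. Qed.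

Lemma pabs_nat_le1 n : pabs n%:R <= 1.
Proof.
case: n => [|n]; first by rewrite pabs0.
by rewrite pabs_nat// invf_le1 ?exprn_gt0// exprn_ege1// ltW.
Qed.

Lemma pabs_int_le1 (z : int) : pabs z%:~R <= 1.
Proof. by rewrite pabs_int_abs pabs_nat_le1. Qed.

Lemma pabs_p : pabs p%:R = p%:R^-1.
Proof. by rewrite pabs_nat ?prime_gt0// logn_prime// eqxx expr1. Qed.

Lemma pabs_pX n : pabs (p ^ n)%:R = p%:R ^- n.
Proof. by rewrite natrX pabsX pabs_p exprVn. Qed.

(** A nonzero integer is at least as large as the power of $p$ dividing it. *)
Lemma pabs_product_le (z : int) : z != 0 -> 1 <= `|z|%:~R * pabs z%:~R.
Proof.
move=> z0; have n0 : (0 < `|z|)%N by rewrite absz_gt0.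
rewrite pabs_int_abs pabs_nat// -[`|z|%R]abszE ler_pdivlMr ?exprn_gt0// mul1r.
by rewrite -pmulrn -natrX ler_nat dvdn_leq// pfactor_dvdnn.
Qed.

Lemma pabs_int_dvd (z : int) k :
  (pabs z%:~R <= p%:R ^- k) = ((p ^ k)%:Z %| z)%Z.
Proof.
rewrite pabs_int_abs dvdzE /=; case: (posnP `|z|%N) => [->|n0].
  by rewrite pabs0 dvdn0 invr_ge0 exprn_ge0// ltW.
rewrite pabs_nat// lef_pV2 ?posrE ?exprn_gt0// ler_eXn2l// pfactor_dvdn//.
Qed.

Lemma pexp_small e : 0 < e -> exists k, p%:R ^- k < e :> rat.
Proof.
move=> e0; exists `|denq e|%N.
have n0 : (0 < `|denq e|)%N by rewrite absz_gt0 denq_neq0.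
apply: (@lt_le_trans _ _ (`|denq e|%N%:R^-1)).
  rewrite ltf_pV2 ?posrE ?exprn_gt0 ?p0 ?ltr0n// -natrX ltr_nat ltn_expl// prime_gt1//.
rewrite -[leRHS]divq_num_den pmulrn absz_denq ler_peMl ?invr_ge0 ?ler0z//.
by rewrite (ler_int _ 1) -gtz0_ge1 numq_gt0.
Qed.

End PadicNorm.

Arguments pabs {p} pp q.
Arguments padic_of_rat {p} pp q.

(** * Limits of rational sequences in the p-adic numbers *)

Section RatLimits.
Variables (p : nat) (pp : prime p).
Local Notation Zp := (padic_int pp).
Local Notation Qp := (padic pp).
Local Notation norm := (@padic_norm p pp).
Local Notation pabs := (pabs pp).
Local Notation padic_of_rat := (padic_of_rat pp).
Implicit Types (u v : nat -> rat) (l : Qp).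

Let p0 : 0 < p%:R :> rat. Proof. by rewrite ltr0n prime_gt0. Qed.
Let p1 : 1 < p%:R :> rat. Proof. by rewrite ltr1n prime_gt1. Qed.

Definition rat_cvg u l := forall e, 0 < e ->
  exists N, forall n, (N <= n)%N -> norm (padic_of_rat (u n) - l) < e.

Definition rat_null u := forall e, 0 < e ->
  exists N, forall n, (N <= n)%N -> pabs (u n) < e.

Lemma rat_cvg0 u : rat_cvg u 0 <-> rat_null u.
Proof.
by split=> h e /h[N hN]; exists N => n /hN; rewrite pabsE subr0.
Qed.

Lemma rat_cvg_unique u l l' : rat_cvg u l -> rat_cvg u l' -> l = l'.
Proof.
move=> ul ul'; apply/eqP; rewrite -subr_eq0 -padic_norm_eq0.
rewrite eq_le padic_norm_ge0 andbT leNgt; apply/negP => e0.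
have [N hN] := ul _ e0; have [N' hN'] := ul' _ e0.
have := hN _ (leq_maxl N N'); have := hN' _ (leq_maxr N N').
move: (padic_of_rat _) => a h' h.
have : norm ((l - a) + (a - l')) < norm (l - l').
  by apply: padic_normD_lt; rewrite // -opprB padic_normN.
by rewrite subrKA ltxx.
Qed.

Lemma rat_cvg_cst b : rat_cvg (fun=> b) (padic_of_rat b).
Proof. by move=> e e0; exists 0%N => n _; rewrite subrr padic_norm0. Qed.

Lemma rat_cvgD u v l l' :
  rat_cvg u l -> rat_cvg v l' -> rat_cvg (fun n => u n + v n) (l + l').
Proof.
move=> ul vl e e0; have [N hN] := ul _ e0; have [N' hN'] := vl _ e0.
exists (maxn N N') => n; rewrite geq_max => /andP[/hN h /hN' h'].
by rewrite rmorphD opprD addrACA; apply: padic_normD_lt.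
Qed.

Lemma rat_cvgZ b u l : rat_cvg u l -> rat_cvg (fun n => b * u n) (padic_of_rat b * l).
Proof.
case: (eqVneq b 0) => [->|b0 ul e e0].
  move=> _ e e0; exists 0%N => n _.
  by rewrite mul0r rmorph0 mul0r subrr padic_norm0.
have nb0 : 0 < pabs b by rewrite pabs_gt0.
have [N hN] := ul (e / pabs b) (divr_gt0 e0 nb0).
exists N => n /hN; rewrite rmorphM -mulrBr padic_normM -(pabsE pp b).
by rewrite ltr_pdivlMr// mulrC.
Qed.

Lemma rat_cvgB u v l l' :
  rat_cvg u l -> rat_cvg v l' -> rat_cvg (fun n => u n - v n) (l - l').
Proof.
move=> ul /(rat_cvgZ (-1)) vl.
have := rat_cvgD ul vl; rewrite rmorphN1 mulN1r.
by move=> h e /h[N hN]; exists N => n /hN; rewrite mulN1r.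
Qed.

Lemma rat_cvg_near u v l :
  rat_cvg u l -> rat_null (fun n => u n - v n) -> rat_cvg v l.
Proof.
move=> ul uv; have uv0 := (rat_cvg0 (fun n => u n - v n)).2 uv.
have := rat_cvgB ul uv0; rewrite subr0.
by move=> h e /h[N hN]; exists N => n /hN; rewrite subKr.
Qed.

Lemma rat_cvg_rat u b : rat_cvg u (padic_of_rat b) -> rat_null (fun n => u n - b).
Proof.
move=> h; apply/(rat_cvg0 (fun n => u n - b)); rewrite -(subrr (padic_of_rat b)).
exact: rat_cvgB h (rat_cvg_cst b).
Qed.

Lemma rat_cvg_series (a : nat -> rat) (w : nat -> Qp) l :
  (forall j, w j = padic_of_rat (a j)) ->
  rat_cvg (fun n => \sum_(j < n) a j) l -> padic_series w = l.
Proof.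
move=> wa al; apply: cvg_lim; first exact: metric_hausdorff.
apply/metricType_numDomainType.cvgrPdist_lt => e /al[N hN]; exists N => // n /hN.
rewrite rmorph_sum /= /series /= big_mkord => h.
rewrite -[mdist _ _]/(norm (l - _)) -opprB padic_normN.
by under eq_bigr do rewrite wa.
Qed.

Lemma rat_null_geometric u (c : rat) :
  (forall n, pabs (u n) <= c * n.+1%:R / p%:R ^+ n) -> rat_null u.
Proof.
move=> uc; have sq n : (n.+1 ^ 2 <= 4 * 2 ^ n)%N.
  elim: n => [|[|[|n]] IHn] //.
  by rewrite [(2 ^ n.+3)%N]expnS; move: IHn; move: (2 ^ n.+2)%N => a; rewrite -!mulnn; nia.
move=> e e0; have c0 : 0 <= c.
  by have := le_trans (pabs_ge0 pp (u 0%N)) (uc 0%N); rewrite expr0 divr1 mulr1.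
exists (Num.bound (4 * c / e)) => n le_n; apply: le_lt_trans (uc n) _.
have n0 : 0 < n.+1%:R :> rat by rewrite ltr0n.
have le1 : c * n.+1%:R / p%:R ^+ n <= c * (4 / n.+1%:R).
  rewrite -mulrA ler_wpM2l// ler_pdivrMr ?exprn_gt0// mulrAC ler_pdivlMr//.
  apply: (@le_trans _ _ (4 * 2 ^+ n)); last first.
    by rewrite ler_pM2l// lerXn2r ?nnegrE ?ler0n// ler_nat prime_gt1.
  by rewrite -natrX -!natrM ler_nat -[X in (X <= _)%N]/(n.+1 ^ 2)%N.
apply: le_lt_trans le1 _; rewrite mulrA ltr_pdivrMr// [c * _]mulrC.
rewrite [e * _]mulrC -ltr_pdivrMr//; apply: lt_le_trans (archi_boundP _) _.
  by rewrite divr_ge0 ?mulr_ge0// ltW.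
by rewrite ler_nat (leq_trans le_n).
Qed.

(** An ultrametric telescope: if the terms $c_n$ decrease strictly, the first
    one dominates the sum of all the later ones. *)
Lemma pabs_telescope (g c : nat -> rat) :
  (forall n, g n = c n + g n.+1) -> (forall n, pabs (c n.+1) < pabs (c n)) ->
  rat_null g -> forall n, pabs (g n) = pabs (c n).
Proof.
move=> gc c_decr g0 n; rewrite gc; apply: pabsD_dominant.
have b0 : 0 < pabs (c n) by apply: le_lt_trans (c_decr n); apply: pabs_ge0.
have c_lt m : (n < m)%N -> pabs (c m) < pabs (c n).
  elim: m => // m IHm; rewrite ltnS leq_eqVlt => /orP[/eqP <- //|/IHm].
  exact: lt_trans (c_decr m).
have [N hN] := g0 _ b0.
have g_lt d m : (n < m)%N -> pabs (g (m + d)%N) < pabs (c n) ->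
    pabs (g m) < pabs (c n).
  elim: d m => [|d IHd] m nm; first by rewrite addn0.
  rewrite addnS -addSn => /(IHd m.+1 (ltnW nm)) h.
  by rewrite gc; apply: pabsD_lt => //; apply: c_lt.
by apply: (g_lt N) => //; apply: hN; rewrite leq_addl.
Qed.

Lemma int_approx q k : pabs q <= 1 -> exists t : int, pabs (q - t%:~R) <= p%:R ^- k.
Proof.
move=> q1; have co : coprimez (denq q) (p ^ k)%:Z.
  rewrite coprimezE /= coprimeXr// coprime_sym prime_coprime//.
  apply/negP => p_den.
  have dn : coprime p `|numq q|.
    by have := coprime_num_den q; rewrite coprime_sym; apply: coprime_dvdl.
  have n0 : (0 < `|numq q|)%N.
    case: posnP dn => // ->; rewrite /coprime gcdn0 => /eqP e.
    by move: (prime_gt1 pp); rewrite e.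
  have d0 : (0 < `|denq q|)%N by rewrite absz_gt0 denq_neq0.
  move: q1; rewrite -[q in pabs q]divq_num_den pabsM pabsV !pabs_int_abs.
  rewrite !pabs_nat// logn_coprime// expr0 invr1 mul1r invrK leNgt.
  by rewrite exprn_egt1 // -lt0n logn_gt0 mem_primes pp d0 p_den.
have [[w z] /= wz] := coprimezP _ _ co.
have d0 : (denq q)%:~R != 0 :> rat by rewrite intr_eq0 denq_neq0.
exists (numq q * w).
have E (n d a b c : rat) : d != 0 -> a * d + b * c = 1 ->
    n / d - n * a = n / d * b * c.
  move=> dn0 /(canRL (addKr _)) bc; rewrite -mulrA bc; field.
  exact: dn0.
have -> : q - (numq q * w)%:~R = q * z%:~R * (p ^ k)%:R.
  rewrite intrM; set n := numq q; have -> : q = n%:~R / (denq q)%:~R.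
    by rewrite divq_num_den.
  apply: E => //; by rewrite pmulrn -!intrM -intrD wz.
rewrite !pabsM pabs_pX ler_piMl ?invr_ge0 ?exprn_ge0 ?(ltW p0)//.
by rewrite mulr_ile1 ?pabs_ge0// pabs_int_le1.
Qed.

(** The residues of the limit are read off integers approximating the
    sequence. *)
Lemma rat_cauchy_cvg u : (forall n, pabs (u n) <= 1) ->
  (forall e, 0 < e ->
     exists N, forall n, (N <= n)%N -> pabs (u n - u N) < e) ->
  exists l, rat_cvg u l.
Proof.
move=> u1 u_cauchy.
have near_int k : exists t : int, exists N, forall n, (N <= n)%N ->
    pabs (u n - t%:~R) <= p%:R ^- k.
  have [|N hN] := u_cauchy (p%:R ^- k); first by rewrite invr_gt0 exprn_gt0.
  have [t ht] := int_approx k (u1 N); exists t; exists N => n le_n.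
  rewrite -(subrK (u N) (u n)) -addrA; apply: pabsD_le => //.
  exact: ltW (hN n le_n).
have [f hf] := choice near_int.
have f_step k : (f k.+1 = f k %[mod (p ^ k)%:Z])%Z.
  apply/eqP; rewrite eqz_mod_dvd -(pabs_int_dvd pp) intrB.
  have [N hN] := hf k; have [N' hN'] := hf k.+1.
  have := hN _ (leq_maxl N N'); have := hN' _ (leq_maxr N N').
  move: (u _) => a h' h; rewrite -(subrK a (f k.+1)%:~R) -addrA.
  apply: pabsD_le => //; rewrite pabsB; apply: le_trans h' _.
  rewrite lef_pV2 ?posrE ?exprn_gt0//; exact/ler_weXn2l/leqnSn/ltW.
pose l : Zp := padic_of_seq pp f_step.
exists (padic_of_int l) => e /(pexp_small pp)[k hk].
have [N hN] := hf k; exists N => n /hN un; apply: le_lt_trans hk.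
rewrite -(subrK (padic_of_rat (f k)%:~R) (padic_of_rat (u n))) -addrA.
apply: padic_normD_le; first by rewrite -rmorphB -pabsE.
have int_res (t : int) j : ((t%:~R : Zp) j = t %% (p ^ j)%:Z)%Z.
  case: t => m; first by rewrite -pmulrn padic_int_natE.
  by rewrite NegzE mulrNz -pmulrn padic_intNE padic_int_natE modzNm.
rewrite rmorph_int -(rmorph_int (@padic_of_int p pp)) -rmorphB padic_norm_int.
apply/padic_int_norm_leP; rewrite padic_intDE padic_intNE int_res /=.
by rewrite modzDmr subrr mod0z.
Qed.

Lemma rat_series_cvg (a : nat -> rat) :
  (forall j, pabs (a j) <= 1) -> rat_null a ->
  exists l, rat_cvg (fun n => \sum_(j < n) a j) l.
Proof.
move=> a1 a0; apply: rat_cauchy_cvg => [n|e e0].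
  by apply: pabs_sum_le.
have [N hN] := a0 _ e0; exists N => n le_Nn.
rewrite -(subnKC le_Nn) big_split_ord /= addrAC subrr add0r.
by apply: pabs_sum_lt => // i _; apply: hN; rewrite leq_addr.
Qed.

End RatLimits.

Arguments rat_cvg {p} pp u l.
Arguments rat_null {p} pp u.

(** * Irrationality of the Newton series *)

Section NodeAbs.
Variables (p : nat) (pp : prime p) (y : rat).
Local Notation pabs := (pabs pp).
Hypothesis y_gt1 : 1 < pabs y.

Lemma pabs_node j : pabs (y - j%:R ^+ 2) = pabs y.
Proof.
rewrite pabsD_dominant// pabsN pabsX; apply: le_lt_trans y_gt1.
by rewrite expr_le1 ?pabs_ge0// pabs_nat_le1.
Qed.

Lemma pabs_node_prod k : pabs (node_prod y k) = pabs y ^+ k.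
Proof.
elim: k => [|k IHk]; first by rewrite /node_prod big_ord0 pabs1.
by rewrite node_prodS pabsM IHk pabs_node exprSr.
Qed.

Lemma node_neq0 j : y - j%:R ^+ 2 != 0.
Proof. by rewrite -(pabs_gt0 pp) pabs_node (lt_trans ltr01). Qed.

End NodeAbs.

Section Irrationality.
Variables (p : nat) (pp : prime p) (r : nat) (b : int).
Hypotheses (r_gt0 : (0 < r)%N) (b_unit : coprime p `|b|).
Hypothesis b_le : `|b| <= (p ^ r)%:Z.
Local Notation pabs := (pabs pp).

Let x : rat := b%:~R / (p ^ r)%:R.
Let y : rat := x ^+ 2.
Let Y : rat := (p ^ (2 * r))%:R.

Let p0 : 0 < p%:R :> rat. Proof. by rewrite ltr0n prime_gt0. Qed.
Let p1 : 1 < p%:R :> rat. Proof. by rewrite ltr1n prime_gt1. Qed.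

Let Y_gt1 : 1 < Y.
Proof. by rewrite /Y natrX exprn_egt1 // muln_eq0 /= -lt0n r_gt0. Qed.

Let Y_gt0 : 0 < Y. Proof. exact: lt_trans Y_gt1. Qed.

Let pabs_y : pabs y = Y.
Proof.
rewrite /y /x pabsX pabsM pabsV pabs_pX pabs_int_abs invrK.
have b0 : (0 < `|b|)%N.
  case: posnP b_unit => // ->; rewrite /coprime gcdn0 => /eqP e.
  by move: (prime_gt1 pp); rewrite e.
by rewrite pabs_nat// logn_coprime// expr0 invr1 mul1r /Y natrX -exprM mulnC.
Qed.

Let y01 : 0 <= y <= 1.
Proof.
rewrite /y sqr_ge0 -(real_normK (num_real x)) expr_le1//= /x normrM normfV.
rewrite normr_nat ler_pdivrMr ?mul1r ?ltr0n ?expn_gt0 ?prime_gt0//.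
by rewrite -intr_norm pmulrn ler_int.
Qed.

Let y_node j : y - j%:R ^+ 2 != 0.
Proof. by apply: (@node_neq0 _ pp); rewrite pabs_y. Qed.

Let node_abs k : pabs (node_prod y k) = Y ^+ k.
Proof. by rewrite pabs_node_prod pabs_y. Qed.

Let fac k : rat := pabs k`!%:R.

Let fac_gt0 k : 0 < fac k. Proof. by rewrite /fac pabs_gt0 factr_neq0. Qed.

Let facS k : fac k.+1 = pabs k.+1%:R * fac k.
Proof. by rewrite /fac factrS pabsM. Qed.

Let nat_gt0 k : 0 < pabs k.+1%:R. Proof. by rewrite pabs_gt0 pnatr_eq0. Qed.

Let nat_le1 k : pabs k.+1%:R <= 1. Proof. exact: pabs_nat_le1. Qed.

Let pabs_node_term k : pabs (node_term y k) = Y ^+ k / fac k ^+ 2.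
Proof. by rewrite /node_term pabsM pabsV pabsX node_abs. Qed.

Let pabs_newton_term i : pabs (newton_term y i) = fac i ^+ 2 / Y ^+ i.+1.
Proof.
by rewrite /newton_term 2!pabsM pabsV pabs_sign pabsX node_abs mul1r.
Qed.

Let node_term_incr k : pabs (node_term y k) < pabs (node_term y k.+1).
Proof.
rewrite !pabs_node_term facS exprMn (exprS Y).
set a := Y ^+ k; set c := fac k ^+ 2; set d := pabs _ ^+ 2.
have a0 : 0 < a by rewrite exprn_gt0.
have c0 : 0 < c by rewrite exprn_gt0.
have d0 : 0 < d by rewrite exprn_gt0.
have d1 : d <= 1 by rewrite expr_le1// ltW.
have -> : Y * a / (d * c) = Y / d * (a / c) by field; rewrite !gt_eqF.
rewrite ltr_pMl ?divr_gt0// ltr_pdivlMr// mul1r.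
exact: le_lt_trans Y_gt1.
Qed.

Let pabs_den n : pabs (approx_den y n) = pabs (node_term y n).
Proof.
rewrite /approx_den /binom_transform big_ord_recr /= binn mulr1n addrC.
apply: pabsD_dominant; apply: pabs_sum_lt => [|k _].
  by rewrite pabs_node_term divr_gt0 ?exprn_gt0.
rewrite -mulr_natr pabsM.
apply: (@le_lt_trans _ _ (pabs (node_term y k))).
  by rewrite ler_piMr ?pabs_ge0 ?pabs_nat_le1.
move: (nat_of_ord k) (ltn_ord k) => {k} i; elim: n => // m IHm.
rewrite ltnS leq_eqVlt.
by case/orP => [/eqP ->//|/IHm h]; exact: lt_trans h (node_term_incr m).
Qed.

Let den_neq0 n : approx_den y n != 0.
Proof.
by rewrite -(pabs_gt0 pp) pabs_den pabs_node_term divr_gt0 ?exprn_gt0.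
Qed.

Variable beta : rat.
Hypothesis beta_lim : rat_null pp (fun n => newton_sum y n - beta).

Let rem n := approx_den y n * beta - approx_num y n.

Let pabs_tail k : pabs (beta - newton_sum y k) = pabs (newton_term y k).
Proof.
apply: (@pabs_telescope _ pp (fun k => beta - newton_sum y k)).
- by move=> n; rewrite /newton_sum big_ord_recr /=; ring.
- move=> n; rewrite !pabs_newton_term facS exprMn (exprS Y).
  set a := Y ^+ n.+1; set c := fac n ^+ 2; set d := pabs _ ^+ 2.
  have a0 : 0 < a by rewrite exprn_gt0.
  have c0 : 0 < c by rewrite exprn_gt0.
  have d1 : d <= 1 by rewrite expr_le1// ltW.
  have -> : d * c / (Y * a) = d / Y * (c / a) by field; rewrite !gt_eqF.
  rewrite gtr_pMl ?divr_gt0// ltr_pdivrMr// mul1r.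
  exact: le_lt_trans Y_gt1.
- by move=> e /beta_lim[N hN]; exists N => n /hN; rewrite pabsB.
Qed.

Let rem_le n : pabs (rem n) <= Y^-1.
Proof.
have -> : rem n = \sum_(k < n.+1)
    node_term y k * (beta - newton_sum y k) *+ 'C(n, k).
  rewrite /rem /approx_den /approx_num /binom_transform big_distrl /= -sumrB.
  by apply: eq_bigr => k _; rewrite mulrBr mulrnBl mulrnAl.
apply: pabs_sum_le => [|k _]; first by rewrite invr_ge0 ltW.
rewrite -mulr_natr pabsM.
apply: le_trans (ler_piMr (pabs_ge0 _ _) (pabs_nat_le1 _ _)) _.
rewrite pabsM pabs_tail pabs_node_term pabs_newton_term.
have := fac_gt0 k; have : 0 < Y ^+ k by rewrite exprn_gt0.
rewrite (exprS Y); move: (fac k) (Y ^+ k) => c a a0 c0.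
have -> : a / c ^+ 2 * (c ^+ 2 / (Y * a)) = Y^-1.
  by field; rewrite !gt_eqF.
exact: lexx.
Qed.

(** The convergents $P_n/Q_n$ telescope, by the Casoratian, into the series with
    terms $1/((n+1)Q_nQ_{n+1})$; the first neglected term is therefore the exact
    size of the error, which in particular does not vanish. *)
Let pabs_rem n :
  pabs (rem n) = fac n ^+ 2 * pabs n.+1%:R / Y ^+ n.+1.
Proof.
pose c n := (n.+1%:R * (approx_den y n * approx_den y n.+1))^-1.
pose g n := rem n / approx_den y n.
have pabs_c m : pabs (c m) =
    fac m ^+ 2 * pabs m.+1%:R / Y ^+ m.+1 * (fac m ^+ 2 / Y ^+ m).
  rewrite /c pabsV 2!pabsM !pabs_den !pabs_node_term facS.
  have := fac_gt0 m; have : 0 < Y ^+ m by rewrite exprn_gt0.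
  rewrite (exprS Y); have := nat_gt0 m.
  move: (pabs _) (fac m) (Y ^+ m) => d f a d0 a0 f0.
  by field; rewrite !gt_eqF.
have gE : forall n, pabs (g n) = pabs (c n).
  apply: (@pabs_telescope _ pp) => [m|m|].
  - have m0 : m.+1%:R != 0 :> rat by rewrite pnatr_eq0.
    have cas := approx_casoratian y_node m; rewrite /g /rem /c.
    rewrite invfM -cas.
    have := den_neq0 m; have := den_neq0 m.+1.
    move: (approx_den y m) (approx_den y m.+1) => u v v0 u0.
    by field; rewrite u0 v0.
  - rewrite !pabs_c facS !(exprS Y).
    have := fac_gt0 m; have : 0 < Y ^+ m by rewrite exprn_gt0.
    have := nat_gt0 m; have := nat_le1 m; have := nat_gt0 m.+1.
    have := nat_le1 m.+1; move: (pabs _) (pabs _) (fac m) (Y ^+ m).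
    move=> d d2 f a d21 d20 d1 d0 a0 f0.
    have -> : (d * f) ^+ 2 * d2 / (Y * (Y * a)) * ((d * f) ^+ 2 / (Y * a)) =
      (d ^+ 3 * d2 / (Y * Y)) * (f ^+ 2 * d / (Y * a) * (f ^+ 2 / a)).
      by field; rewrite !gt_eqF.
    rewrite gtr_pMl; last by rewrite !(mulr_gt0, invr_gt0, exprn_gt0).
    rewrite ltr_pdivrMr ?mulr_gt0// mul1r.
    apply: (@le_lt_trans _ _ 1); last by rewrite mulr_egt1.
    by rewrite mulr_ile1 ?exprn_ge0 ?expr_le1// ltW.
  - apply: (@rat_null_geometric _ pp g 1) => m; rewrite /g pabsM pabsV.
    rewrite pabs_den pabs_node_term invf_div mul1r.
    have fm : fac m ^+ 2 <= 1 by rewrite expr_le1 ?pabs_nat_le1// ltW.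
    have Yp : p%:R ^+ m <= Y ^+ m.
      apply: lerXn2r; rewrite ?nnegrE ?(ltW p0) ?(ltW Y_gt0)// /Y natrX.
      by rewrite ler_eXnr ?(ltW p1)// muln_gt0.
    have Ym : 0 < Y ^+ m by rewrite exprn_gt0.
    apply: (@le_trans _ _ (1 / Y ^+ m)).
      have h1 : pabs (rem m) <= 1.
        by apply: le_trans (rem_le m) _; rewrite invf_le1 ?ltW.
      have h2 : fac m ^+ 2 / Y ^+ m <= 1 / Y ^+ m by rewrite ler_pM2r ?invr_gt0.
      rewrite -[leRHS]mul1r; apply: ler_pM h1 h2; first exact: pabs_ge0.
      by rewrite ltW// divr_gt0// exprn_gt0.
    rewrite ler_pM ?invr_ge0 ?ler1n ?(ltW Ym)//.
    by rewrite lef_pV2 ?posrE ?exprn_gt0.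
have -> : rem n = g n * approx_den y n by rewrite /g divfK.
rewrite pabsM gE pabs_c pabs_den pabs_node_term.
have := fac_gt0 n; have : 0 < Y ^+ n by rewrite exprn_gt0.
rewrite (exprS Y); move: (pabs _) (fac n) (Y ^+ n) => d f a a0 f0.
by field; rewrite !gt_eqF.
Qed.

(** $D_nR_n$ times the denominator of $\beta$ is a nonzero integer, of size at
    most a multiple of $(n+1)\,d_n^2g_n^2$ and divisible by $g_n^4$. *)
Lemma newton_sum_clear_le :
  exists C : nat, forall n,
    (binom_clear p r n ^ 2 <= lcm_upto n ^ 2 * (n.+1 * C))%N.
Proof.
set A := numq beta; set B := denq beta.
exists (`|A| + `|B|)%N => n; set g := binom_clear p r n; set d := lcm_upto n.
set D := approx_clear p r n.
have B0 : B%:~R != 0 :> rat by rewrite intr_eq0 denq_neq0.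
have [s es] : exists s : int, s%:~R = D%:R * approx_den y n.
  by have /intrP[s ->] := approx_den_clear r b pp n; exists s.
have [t et] : exists t : int, t%:~R = D%:R * approx_num y n.
  by have /intrP[t ->] := approx_num_clear pp n y_node; exists t.
set z : int := s * A - t * B.
have ez : z%:~R = D%:R * B%:~R * rem n.
  rewrite /z intrB !intrM es et /rem -[beta in RHS]divq_num_den -/A -/B.
  by field.
have g0 : 0 < g%:R :> rat by rewrite ltr0n expn_gt0 prime_gt0.
have d0 : 0 < d%:R :> rat by rewrite ltr0n lcm_upto_gt0.
have D0 : 0 < D%:R :> rat by rewrite /D /approx_clear natrX natrM exprn_gt0// mulr_gt0.
have rem_gt0 : 0 < pabs (rem n).
  by rewrite pabs_rem divr_gt0 ?mulr_gt0 ?exprn_gt0.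
have z0 : z != 0.
  by rewrite -(intr_eq0 rat) ez 2?mulf_neq0 ?(gt_eqF D0)// -(pabs_gt0 pp).
have fac_g : fac n ^+ 2 / Y ^+ n = g%:R ^- 2.
  rewrite /fac pabs_nat ?fact_gt0// /Y /g /binom_clear !natrX.
  rewrite -!exprM -exprVn -!exprM exprVn -invfM -exprD.
  by congr (_ ^- _); move: (logn _ _) => v; clear; lia.
have pz : pabs z%:~R <= g%:R ^- 4.
  have -> : g%:R ^- 4 = g%:R ^- 2 * g%:R ^- 2 :> rat by rewrite -invfM -exprD.
  rewrite ez -mulrA pabsM ler_pM ?pabs_ge0//.
    rewrite /D /approx_clear natrX pabsX natrM pabsM exprMn -exprVn.
    have -> : pabs g%:R = g%:R^-1 by rewrite /g /binom_clear pabs_pX natrX.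
    by rewrite ler_piMl ?exprn_ge0 ?invr_ge0 ?(ltW g0)// expr_le1 ?pabs_ge0// pabs_nat_le1.
  rewrite pabsM -fac_g -[leRHS]mul1r ler_pM ?pabs_ge0 ?pabs_int_le1//.
  rewrite pabs_rem (exprS Y) invfM mulrA ler_pM2r ?invr_gt0 ?exprn_gt0//.
  have f2 : 0 < fac n ^+ 2 by rewrite exprn_gt0.
  rewrite -mulrA ler_piMr ?(ltW f2)// mulr_ile1 ?pabs_ge0 ?invr_ge0 ?(ltW Y_gt0)//.
  by rewrite invf_le1 ?ltW.
have az : `|z|%:~R <= d%:R ^+ 2 * g%:R ^+ 2 * (n.+1%:R * (`|A|%N + `|B|%N)%:R) :> rat.
  have /andP[/andP[Q0 Q1] /andP[P0 P1]] := approx_bounds y_node n y01.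
  have -> : d%:R ^+ 2 * g%:R ^+ 2 = D%:R :> rat.
    by rewrite /D /approx_clear natrX natrM exprMn.
  have -> : `|z|%:~R = D%:R * `|approx_den y n * A%:~R - approx_num y n * B%:~R|.
    rewrite intr_norm ez /rem -[beta]divq_num_den -/A -/B.
    rewrite -[D%:R in RHS]gtr0_norm// -normrM; congr `|_|.
    by field.
  rewrite ler_pM2l// natrD mulrDr; apply: le_trans (ler_normB _ _) _.
  have absz_rat (a : int) : `|a|%N%:R = `|a%:~R| :> rat.
    by rewrite -intr_norm -abszE pmulrn.
  rewrite !normrM !absz_rat (ger0_norm Q0) (ger0_norm P0).
  by apply: lerD; apply: ler_wpM2r.
have := pabs_product_le pp z0.
have zz : `|z|%:~R * pabs z%:~R <=
    (d%:R ^+ 2 * g%:R ^+ 2 * (n.+1%:R * (`|A|%N + `|B|%N)%:R)) * g%:R ^- 4.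
  by apply: ler_pM; rewrite ?pabs_ge0 ?ler0z.
move=> /le_trans /(_ zz).
have -> : d%:R ^+ 2 * g%:R ^+ 2 * (n.+1%:R * (`|A|%N + `|B|%N)%:R) * g%:R ^- 4 =
    d%:R ^+ 2 * (n.+1%:R * (`|A|%N + `|B|%N)%:R) / g%:R ^+ 2 :> rat.
  by move: (_ * (`|A|%N + `|B|%N)%:R) => a; field; rewrite gt_eqF.
by rewrite ler_pdivlMr ?exprn_gt0// mul1r -!natrX -!natrM ler_nat.
Qed.

End Irrationality.

Section Growth.
Local Open Scope nat_scope.

Lemma poly_lt_exp2 C : exists N, forall n, N <= n -> (n.+1 * C) ^ 20 < 2 ^ n.
Proof.
exists (40 * (40 * C)) => n le_n; set m := n %/ 40.
have le_m : 40 * C <= m by rewrite leq_divRL// mulnC.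
have lt_m : m < 2 ^ m by apply: ltn_expl.
have n_lt : n.+1 <= m.+1 * 40 by rewrite -ltn_divLR.
have lt1 : n.+1 * C < 2 ^ (2 * m).
  apply: (@leq_ltn_trans (2 ^ m * (40 * C))).
    by rewrite mulnA leq_mul2r orbC (leq_trans n_lt)// leq_mul2r lt_m.
  by rewrite mul2n -addnn expnD ltn_pmul2l ?expn_gt0// (leq_ltn_trans le_m).
apply: (@leq_trans ((2 ^ (2 * m)) ^ 20)); first by rewrite ltn_exp2r.
by rewrite -expnM leq_exp2l// mulnAC mulnC leq_trunc_div.
Qed.

Lemma logn2_fact k : 7 * k <= logn 2 (8 * k)`!.
Proof.
case: k => // k; rewrite (@logn_fact_upto 2 _ (8 * k.+1)) //.
rewrite big_ltn; last by lia.
rewrite big_ltn; last by lia.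
rewrite big_ltn; last by lia.
move: (\sum_(4 <= i < _) _) => s.
by rewrite -[2 ^ 1]/2 -[2 ^ 2]/4 -[2 ^ 3]/8; lia.
Qed.

Lemma logn3_fact k : k <= logn 3 (3 * k)`!.
Proof.
case: k => // k; rewrite (@logn_fact_upto 3 _ (3 * k.+1)) //.
by rewrite big_ltn ?expn1 ?mulKn ?leq_addr//; lia.
Qed.

(** The numerical margin: $4\cdot 2^{-1/8} > 432^{1/5}$ for $p = 2$. *)
Lemma binom_clear2_large r j : 0 < r -> 2 < j ->
  2 ^ (6 ^ j) * 432 ^ (8 * 6 ^ j) <= binom_clear 2 r (6 ^ j) ^ 40.
Proof.
move=> r0 j3.
have [k ->] : exists k, 6 ^ j = 8 * k.
  by exists (27 * 6 ^ (j - 3)); rewrite mulnA -[8 * 27]/(6 ^ 3) -expnD subnKC.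
apply: (@leq_trans (2 ^ (8 * k) * (2 ^ 9) ^ (8 * (8 * k)))).
  rewrite leq_mul2l; apply/orP; right.
  by case: (8 * (8 * k)) => // e; rewrite leq_exp2r.
rewrite /binom_clear -!expnM -expnD leq_exp2l//.
by have := logn2_fact k; nia.
Qed.

(** The margin is $3^{4/3} > 432^{1/5}$ for $p = 3$. *)
Lemma binom_clear3_large r j : 0 < r -> 0 < j ->
  2 ^ (6 ^ j) * 432 ^ (8 * 6 ^ j) <= binom_clear 3 r (6 ^ j) ^ 40.
Proof.
move=> r0 j0.
have [k ->] : exists k, 6 ^ j = 3 * k.
  by exists (2 * 6 ^ j.-1); rewrite mulnA -[3 * 2]/(6 ^ 1) -expnD add1n prednK.
have -> : 432 = 2 ^ 4 * 3 ^ 3 by [].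
rewrite expnMn -!expnM mulnA -expnD.
apply: (@leq_trans (3 ^ (66 * k) * 3 ^ (3 * (8 * (3 * k))))).
  rewrite leq_mul2r; apply/orP; right.
  have -> : 3 * k + 4 * (8 * (3 * k)) = 3 * (33 * k) by lia.
  have -> : 66 * k = 2 * (33 * k) by lia.
  move: (33 * k) => e; rewrite (expnM 2 3) (expnM 3 2).
  by case: e => // e; rewrite leq_exp2r.
rewrite -expnD leq_exp2l//.
by have := logn3_fact k; nia.
Qed.

End Growth.

Theorem newton_sum_irrational (p : nat) (pp : prime p) (r : nat) (b : int) :
  (0 < r)%N -> coprime p `|b| -> `|b| <= (p ^ r)%:Z ->
  (forall j, (2 < j)%N ->
     (2 ^ (6 ^ j) * 432 ^ (8 * 6 ^ j) <= binom_clear p r (6 ^ j) ^ 40)%N) ->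
  forall beta : rat,
  ~ rat_null pp (fun n => newton_sum ((b%:~R / (p ^ r)%:R) ^+ 2) n - beta).
Proof.
move=> r0 b_unit b_le large beta lim.
have [C hC] := newton_sum_clear_le r0 b_unit b_le lim.
have [N hN] := poly_lt_exp2 C.
set j := maxn N 3; set n := (6 ^ j)%N.
have le_n : (N <= n)%N.
  by apply: leq_trans (ltnW (ltn_expl j (isT : (1 < 6)%N))); rewrite leq_maxl.
have := large j (leq_maxr _ _); have := hN n le_n; have := hC n.
have := lcm_upto_exp6 j; rewrite -/n; move: (lcm_upto n) (binom_clear p r n).
set a := (n.+1 * C)%N => d g le_d le_g lt_a le_gg.
have le40 : (g ^ 40 <= 432 ^ (8 * n) * a ^ 20)%N.
  have -> : (g ^ 40 = (g ^ 2) ^ 20)%N by rewrite -expnM.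
  apply: (@leq_trans ((d ^ 2 * a) ^ 20)); first by rewrite leq_exp2r.
  rewrite expnMn leq_mul2r -expnM -[(2 * 20)%N]/(5 * 8)%N expnM [(8 * n)%N]mulnC.
  by rewrite [(432 ^ _)%N]expnM leq_exp2r ?le_d ?orbT.
have := leq_trans le_gg le40; rewrite mulnC leq_pmul2l ?expn_gt0//.
by rewrite leqNgt lt_a.
Qed.

(** * The Bernoulli functional *)

Definition bernoulli_fun (f : {poly rat}) : rat :=
  \sum_(i < size f) f`_i * bernoulli i.

Lemma bernoulli_fun_widen n (f : {poly rat}) : (size f <= n)%N ->
  bernoulli_fun f = \sum_(i < n) f`_i * bernoulli i.
Proof.
move=> le_n; rewrite /bernoulli_fun (big_ord_widen n (fun i => f`_i * bernoulli i) le_n).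
rewrite big_mkcond; apply: eq_bigr => i _; case: ltnP => // le_i.
by rewrite nth_default// mul0r.
Qed.

Fact bernoulli_fun_is_scalar : scalar bernoulli_fun.
Proof.
move=> a f g; set n := maxn (size f) (size g).
have le_f : (size f <= n)%N by apply: leq_maxl.
have le_g : (size g <= n)%N by apply: leq_maxr.
have le_fg : (size (a *: f + g)%R <= n)%N.
  apply: leq_trans (size_polyD _ _) _; rewrite geq_max le_g andbT.
  exact: leq_trans (size_scale_leq _ _) le_f.
rewrite !(bernoulli_fun_widen le_f, bernoulli_fun_widen le_g, bernoulli_fun_widen le_fg).
rewrite big_distrr -big_split /=; apply: eq_bigr => i _.
by rewrite coefD coefZ mulrDl mulrA.
Qed.

HB.instance Definition _ :=
  GRing.isLinear.Build rat {poly rat} rat *%R bernoulli_fun bernoulli_fun_is_scalar.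

Lemma bernoulli_funXn n : bernoulli_fun 'X^n = bernoulli n.
Proof.
rewrite /bernoulli_fun size_polyXn (bigD1 ord_max) //= coefXn eqxx mul1r.
rewrite big1 ?addr0// => i; rewrite coefXn -val_eqE /= => /negbTE ->.
by rewrite mul0r.
Qed.

Lemma sum_bin_bernoulli n :
  \sum_(k < n.+1) 'C(n.+1, k)%:R * bernoulli k = (n == 0)%:R.
Proof.
have := congr1 (fun z => n.+1`!%:R * z) (bernoulli_gen n).
rewrite big_distrr /=; have -> : n.+1`!%:R * (n == 0)%:R = (n == 0)%:R :> rat.
  by case: (n) => [|m]; rewrite ?mulr1 ?mulr0.
move=> <-; apply: eq_bigr => k _.
have le_k : (k <= n.+1)%N by rewrite ltnW// ltnS ltnW// ltnS; apply: leq_trans (ltn_ord k) _.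
have le_k' : (k <= n)%N by rewrite -ltnS.
rewrite -(bin_fact le_k) (natrM _ _ (_ * _)%N) (natrM _ k`!) (subSn le_k').
have E (x c d z : rat) : c != 0 -> d != 0 -> x * z = x * (c * d) * (z / c / d).
  by move=> c0 d0; field; rewrite c0 d0.
by apply: E; apply: factr_neq0.
Qed.

Section ScalarExpansion.
Variable L : {scalar {poly rat}}.

Lemma scalarXD1 n : L (('X + 1) ^+ n) = \sum_(k < n.+1) 'C(n, k)%:R * L 'X^k.
Proof.
rewrite exprD1n raddf_sum /=; apply: eq_bigr => k _.
by rewrite -scaler_nat linearZ.
Qed.

Lemma scalar_coef (f : {poly rat}) : L f = \sum_(i < size f) f`_i * L 'X^i.
Proof.
rewrite -[in LHS](coefK f) poly_def raddf_sum /=.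
by apply: eq_bigr => i _; rewrite linearZ.
Qed.

(** Both sides are linear in $f$. *)
Lemma scalar_shift_ext :
  (forall n, L (('X + 1) ^+ n) = L 'X^n + (n == 1%N)%:R) ->
  forall f, L (f \Po ('X + 1)) = L f + f`_1.
Proof.
move=> LX f; rewrite -[f]coefK poly_def.
rewrite raddf_sum !raddf_sum /= coef_sum -big_split /=.
apply: eq_bigr => i _; rewrite linearZ /= comp_Xn_poly !linearZ /= LX.
by rewrite mulrDr coefZ coefXn eq_sym.
Qed.

End ScalarExpansion.

Lemma bernoulli_shift (f : {poly rat}) :
  bernoulli_fun (f \Po ('X + 1)) = bernoulli_fun f + f`_1.
Proof.
apply: scalar_shift_ext => -[|n]; first by rewrite !expr0 addr0.
rewrite scalarXD1 big_ord_recr /= binn mul1r addrC; congr (_ + _).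
by under eq_bigr do rewrite bernoulli_funXn; rewrite sum_bin_bernoulli.
Qed.

(** The values at $(X+1)^{n+1} - X^{n+1}$ determine the moments one after
    the other. *)
Lemma bernoulli_fun_unique (L : {scalar {poly rat}}) :
  (forall f, L (f \Po ('X + 1)) = L f + f`_1) -> L =1 bernoulli_fun.
Proof.
move=> Lshift; suff LX n : L 'X^n = bernoulli n.
  by move=> f; rewrite scalar_coef; under eq_bigr do rewrite LX.
elim/ltn_ind: n => n IHn.
have := Lshift 'X^(n.+1); rewrite comp_Xn_poly scalarXD1 big_ord_recr /= binn mul1r.
rewrite addrC => /addrI; rewrite coefXn eqSS eq_sym.
rewrite -sum_bin_bernoulli !big_ord_recr /=.
have -> : \sum_(i < n) 'C(n.+1, i)%:R * L 'X^i = \sum_(i < n) 'C(n.+1, i)%:R * bernoulli i.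
  by apply: eq_bigr => i _; rewrite IHn.
by move/addrI/mulfI; apply; rewrite pnatr_eq0 -lt0n bin_gt0.
Qed.

Lemma coef_comp_scale (a : rat) (f : {poly rat}) i :
  (f \Po (a *: 'X))`_i = f`_i * a ^+ i.
Proof.
rewrite -[f in LHS]coefK poly_def raddf_sum /= coef_sum.
have [le_i|lt_i] := leqP (size f) i.
  rewrite nth_default// mul0r big1// => j _.
  rewrite comp_polyZ comp_Xn_poly exprZn !coefZ coefXn gtn_eqF ?mulr0//.
  exact: leq_trans le_i.
rewrite (bigD1 (Ordinal lt_i)) //= big1 ?addr0 => [|j].
  by rewrite comp_polyZ comp_Xn_poly exprZn !coefZ coefXn eqxx mulr1.
rewrite -val_eqE /= => /negbTE ji.
by rewrite comp_polyZ comp_Xn_poly exprZn !coefZ coefXn eq_sym ji !mulr0.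
Qed.

(** Multiplication formula, by uniqueness: the average of the functional over
    the two residue classes modulo 2 satisfies the same difference equation. *)
Lemma bernoulli_duplication (f : {poly rat}) :
  bernoulli_fun (f \Po (2 *: 'X)) + bernoulli_fun (f \Po (2 *: 'X + 1)) =
  2 * bernoulli_fun f.
Proof.
pose L (g : {poly rat}) : rat := 2^-1 *
  (bernoulli_fun (g \Po (2 *: 'X)) + bernoulli_fun (g \Po (2 *: 'X + 1))).
have L_lin : scalar L.
  by move=> a g h; rewrite /L !(comp_polyD, comp_polyZ) !linearP /=; ring.
pose Lh : {scalar {poly rat}} := HB.pack L
  (GRing.isLinear.Build rat {poly rat} rat *%R L L_lin).
rewrite -(@bernoulli_fun_unique Lh _ f); last first.
  move=> g; rewrite /= /L -!comp_polyA.
  have -> : ('X + 1) \Po (2 *: 'X) = 2 *: 'X + 1 :> {poly rat}.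
    by rewrite comp_polyD comp_polyX comp_polyC.
  have -> : ('X + 1) \Po (2 *: 'X + 1) = (2 *: 'X) \Po ('X + 1) :> {poly rat}.
    rewrite comp_polyD comp_polyX comp_polyC comp_polyZ comp_polyX.
    by rewrite scalerDr -addrA; congr (_ + _); rewrite scaler_nat.
  rewrite comp_polyA bernoulli_shift coef_comp_scale expr1.
  by field.
by rewrite /= /L; field.
Qed.

(** * The Genocchi functional *)

(** Up to a factor, its value at $1/(x+t)$ is the $p$-adic
    $\sum_n(-1)^n/(x+n)^2$, as that of the Bernoulli functional is
    $\sum_n 1/(x+n)^2$; its moments are the Genocchi numbers
    $G_j = 2(1-2^j)B_j$. *)
Definition genocchi_fun (f : {poly rat}) : rat :=
  bernoulli_fun (f \Po (2 *: 'X + 1)) - bernoulli_fun (f \Po (2 *: 'X)).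

Fact genocchi_fun_is_scalar : scalar genocchi_fun.
Proof.
by move=> a f g; rewrite /genocchi_fun !(comp_polyD, comp_polyZ) !linearP /=; ring.
Qed.

HB.instance Definition _ :=
  GRing.isLinear.Build rat {poly rat} rat *%R genocchi_fun genocchi_fun_is_scalar.

Lemma genocchi_shift (f : {poly rat}) :
  genocchi_fun (f \Po ('X + 1)) + genocchi_fun f = 2 * f`_1.
Proof.
rewrite /genocchi_fun -!comp_polyA.
have -> : ('X + 1) \Po (2 *: 'X) = 2 *: 'X + 1 :> {poly rat}.
  by rewrite comp_polyD comp_polyX comp_polyC.
have -> : ('X + 1) \Po (2 *: 'X + 1) = (2 *: 'X) \Po ('X + 1) :> {poly rat}.
  rewrite comp_polyD comp_polyX comp_polyC comp_polyZ comp_polyX.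
  by rewrite scalerDr -addrA; congr (_ + _); rewrite scaler_nat.
rewrite comp_polyA bernoulli_shift coef_comp_scale expr1; ring.
Qed.

Definition even_prod k : {poly rat} := \prod_(j < k) ('X^2 - (j%:R ^+ 2)%:P).

Lemma even_prodS k : even_prod k.+1 = even_prod k * ('X^2 - (k%:R ^+ 2)%:P).
Proof. by rewrite /even_prod big_ord_recr. Qed.

Definition falling_poly k : {poly rat} := \prod_(j < k) ('X - j%:R%:P).
Definition climbing_poly k : {poly rat} := \prod_(j < k) ('X + j%:R%:P).
Definition falling_poly1 k : {poly rat} := \prod_(j < k) ('X - j.+1%:R%:P).
Definition climbing_poly1 k : {poly rat} := \prod_(j < k) ('X + j.+1%:R%:P).

(** Two consecutive runs of $2k$ integers overlap in $2k-1$ places, and the two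
    remaining factors $t+k$ and $t-k$ add up to $2t$. *)
Lemma even_prod_shift_sum k :
  ((falling_poly1 k * climbing_poly k) \Po ('X + 1)) + falling_poly1 k * climbing_poly k =
  2 *: even_prod k.
Proof.
have e_even : even_prod k = falling_poly k * climbing_poly k.
  rewrite /even_prod /falling_poly /climbing_poly -big_split /=; apply: eq_bigr => j _.
  by rewrite rmorphXn /= -subr_sqr.
have e_f : (falling_poly1 k) \Po ('X + 1) = falling_poly k.
  rewrite /falling_poly1 /falling_poly (rmorph_prod (comp_poly ('X + 1))) /=; apply: eq_bigr => j _.
  rewrite comp_polyB comp_polyX comp_polyC -addn1 natrD rmorphD /=.
  by rewrite opprD addrACA subrr addr0.
have e_c : (climbing_poly k) \Po ('X + 1) = climbing_poly1 k.
  rewrite /climbing_poly1 /climbing_poly (rmorph_prod (comp_poly ('X + 1))) /=; apply: eq_bigr => j _.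
  by rewrite comp_polyD comp_polyX comp_polyC -addn1 natrD rmorphD /= -addrA [1 + _]addrC.
have f1 : 'X * falling_poly1 k = falling_poly k * ('X - k%:R%:P).
  transitivity (falling_poly k.+1); last by rewrite /falling_poly big_ord_recr.
  by rewrite /falling_poly big_ord_recl /= subr0.
have c1 : 'X * climbing_poly1 k = climbing_poly k * ('X + k%:R%:P).
  transitivity (climbing_poly k.+1); last by rewrite /climbing_poly big_ord_recr.
  by rewrite /climbing_poly big_ord_recl /= addr0.
have X0 : 'X != 0 :> {poly rat} by rewrite polyX_eq0.
apply: (mulfI X0); rewrite comp_polyM e_f e_c mulrDr e_even.
rewrite (mulrCA 'X (falling_poly k)) c1 (mulrA 'X (falling_poly1 k)) f1.
by rewrite -mul_polyC rmorph_nat; ring.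
Qed.

Lemma genocchi_even_prod k : genocchi_fun (even_prod k.+1) =
  (-1) ^+ k.+1 * (k`!%:R * k.+1`!%:R).
Proof.
have two0 : 2 != 0 :> rat by [].
have gZ : 2 * genocchi_fun (even_prod k.+1) = genocchi_fun (2 *: even_prod k.+1).
  by rewrite linearZ.
apply: (mulfI two0); rewrite gZ -even_prod_shift_sum linearD /= genocchi_shift; congr (_ * _).
have -> : climbing_poly k.+1 = 'X * climbing_poly1 k by rewrite /climbing_poly big_ord_recl /= addr0.
rewrite mulrCA coefXM /= -horner_coef0 hornerM /falling_poly1 /climbing_poly1 !horner_prod.
rewrite [k.+1`!](_ : _ = \prod_(i < k.+1) i.+1)%N; last first.
  by rewrite fact_prod big_add1 big_mkord.
rewrite [k`!](_ : _ = \prod_(i < k) i.+1)%N; last first.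
  by rewrite fact_prod big_add1 big_mkord.
rewrite !natr_prod [in RHS]mulrCA -[X in (-1) ^+ X](card_ord k.+1) -prodr_const.
rewrite -big_split /= mulrC; congr (_ * _).
  by apply: eq_bigr => i _; rewrite !hornerE.
by apply: eq_bigr => i _; rewrite hornerD hornerN hornerX hornerC sub0r mulN1r.
Qed.

Lemma genocchi1 : genocchi_fun 1 = 0.
Proof. by rewrite /genocchi_fun !comp_polyC subrr. Qed.

(** The Newton coefficients behind [newton_term]. They follow from
    $t^2w_k = w_{k+1} + k^2w_k$, where $w_k = \prod_{j<k}(t^2-j^2)$. *)
Lemma genocchi_X2_even_prod k :
  genocchi_fun ('X^2 * even_prod k) = - ((-1) ^+ k * k`!%:R ^+ 2).
Proof.
have -> : 'X^2 * even_prod k = even_prod k.+1 + k%:R ^+ 2 *: even_prod k.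
  by rewrite even_prodS -mul_polyC; ring.
rewrite linearD linearZ /= genocchi_even_prod; case: k => [|k].
  by rewrite expr0n mul0r addr0 !fact0 !factS fact0; ring.
by rewrite genocchi_even_prod (factrS _ k.+1) !(factrS _ k) !exprS; ring.
Qed.

(** * Polynomial approximations of $1/(x+t)$ *)

Section GaussNorm.
Variables (p : nat) (pp : prime p).
Local Notation pabs := (pabs pp).
Implicit Types f g h : {poly rat}.

(** The Gauss norm of $f$ is at most $c$. *)
Definition coef_le (c : rat) f := forall i, pabs f`_i <= c.

Lemma coef_leC c : coef_le (pabs c) c%:P.
Proof. by move=> i; rewrite coefC; case: ifP; rewrite ?pabs0 ?pabs_ge0. Qed.

Lemma coef_leX : coef_le 1 'X.
Proof. by move=> i; rewrite coefX; apply: pabs_nat_le1. Qed.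

Lemma coef_le1 : coef_le 1 1.
Proof. by move=> i; rewrite coef1; apply: pabs_nat_le1. Qed.

Lemma coef_le_int (n : int) : coef_le 1 n%:~R%:P.
Proof. by move=> i; apply: le_trans (coef_leC _ i) (pabs_int_le1 _ _). Qed.

Lemma coef_leD c f g : coef_le c f -> coef_le c g -> coef_le c (f + g).
Proof. by move=> fc gc i; rewrite coefD pabsD_le. Qed.

Lemma coef_leN c f : coef_le c f -> coef_le c (- f).
Proof. by move=> fc i; rewrite coefN pabsN. Qed.

Lemma coef_leW c d f : c <= d -> coef_le c f -> coef_le d f.
Proof. by move=> cd fc i; apply: le_trans (fc i) cd. Qed.

Lemma coef_leM c d f g : coef_le c f -> coef_le d g -> coef_le (c * d) (f * g).
Proof.
move=> fc gd i; have c0 : 0 <= c by apply: le_trans (fc 0%N); apply: pabs_ge0.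
have d0 : 0 <= d by apply: le_trans (gd 0%N); apply: pabs_ge0.
rewrite coefM; apply: pabs_sum_le => [|j _]; first exact: mulr_ge0.
by rewrite pabsM ler_pM ?pabs_ge0.
Qed.

Lemma coef_leZ a c f : coef_le c f -> coef_le (pabs a * c) (a *: f).
Proof. by move=> fc i; rewrite coefZ pabsM ler_wpM2l ?pabs_ge0. Qed.

Lemma coef_le_prod (I : Type) (r : seq I) (P : pred I) (F : I -> {poly rat}) :
  (forall i, coef_le 1 (F i)) -> coef_le 1 (\prod_(i <- r | P i) F i).
Proof.
move=> F1; elim/big_ind: _ => //; first exact: coef_le1.
by move=> f g f1 g1; rewrite -[1]mulr1; apply: coef_leM.
Qed.

Lemma coef_le_comp c f g : coef_le c f -> coef_le 1 g -> coef_le c (f \Po g).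
Proof.
move=> fc g1 i; have c0 : 0 <= c by apply: le_trans (fc 0%N); apply: pabs_ge0.
have gX j : coef_le 1 (g ^+ j).
  by rewrite -[j]card_ord -prodr_const; apply: coef_le_prod.
rewrite comp_polyE coef_sum; apply: pabs_sum_le => // j _.
rewrite coefZ pabsM -[leRHS]mulr1; apply: ler_pM; rewrite ?pabs_ge0//.
exact: gX.
Qed.

End GaussNorm.

Section BernoulliBound.
Variables (p : nat) (pp : prime p).
Local Notation pabs := (pabs pp).
Local Notation coef_le := (coef_le pp).

Lemma falling_polyS n : falling_poly n.+1 = falling_poly n * ('X - n%:R%:P).
Proof. by rewrite /falling_poly big_ord_recr. Qed.

Lemma coef_le_falling n : coef_le 1 (falling_poly n).
Proof.
apply: coef_le_prod => j; apply: coef_leD; first exact: coef_leX.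
rewrite -polyCN; have -> : - j%:R = (- j%:Z)%:~R :> rat by rewrite mulrNz -pmulrn.
exact: coef_le_int.
Qed.

Lemma bernoulli_falling n :
  bernoulli_fun (falling_poly n) = (-1) ^+ n * n`!%:R / n.+1%:R.
Proof.
have n0 : n.+1%:R != 0 :> rat by rewrite pnatr_eq0.
have shift : falling_poly n.+1 \Po ('X + 1) = ('X + 1) * falling_poly n.
  rewrite /falling_poly (rmorph_prod (comp_poly ('X + 1))) big_ord_recl /=.
  rewrite comp_polyB comp_polyX comp_polyC subr0; congr (_ * _).
  apply: eq_bigr => j _; rewrite comp_polyB comp_polyX comp_polyC /bump /= add1n.
  by rewrite -addn1 natrD polyCD opprD addrACA subrr addr0.
have := bernoulli_shift (falling_poly n.+1); rewrite shift.
have -> : ('X + 1) * falling_poly n = falling_poly n.+1 + n.+1%:R *: falling_poly n.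
  by rewrite falling_polyS -addn1 natrD -mul_polyC polyCD; ring.
rewrite linearD linearZ /= => /addrI e; apply: (mulfI n0); rewrite e.
have -> : falling_poly n.+1 = 'X * \prod_(j < n) ('X - j.+1%:R%:P).
  by rewrite /falling_poly big_ord_recl /= subr0.
rewrite coefXM /= -horner_coef0 horner_prod mulrC divfK//.
rewrite fact_prod big_add1 big_mkord natr_prod -[X in (-1) ^+ X](card_ord n).
rewrite -prodr_const -big_split /=; apply: eq_bigr => j _.
by rewrite hornerD hornerN hornerX hornerC sub0r mulN1r.
Qed.

(** On the basis of falling factorials, over which polynomials with
    $p$-integral coefficients expand integrally, the functional takes the values
    $\pm n!/(n+1)$. *)
Lemma bernoulli_fun_le c n (f : {poly rat}) :
  (size f <= n)%N -> coef_le c f -> pabs (bernoulli_fun f) <= c * n%:R.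
Proof.
elim: n f => [|n IHn] f le_n fc.
  move: le_n; rewrite leqn0 size_poly_eq0 => /eqP ->.
  by rewrite linear0 pabs0 mulr0.
have c0 : 0 <= c by apply: le_trans (fc 0%N); apply: pabs_ge0.
have c_coef : coef_le c (f`_n *: falling_poly n).
  move=> i; rewrite coefZ pabsM -[leRHS]mulr1; apply: ler_pM; rewrite ?pabs_ge0//.
  exact: coef_le_falling.
set g := f - f`_n *: falling_poly n.
have le_g : (size g <= n)%N.
  have e : falling_poly n = \prod_(j <- iota 0 n) ('X - (j%:R : rat)%:P).
    rewrite /falling_poly -(big_mkord xpredT (fun j => 'X - (j%:R : rat)%:P)).
    by rewrite /index_iota subn0.
  have sz : size (falling_poly n) = n.+1 by rewrite e size_prod_XsubC size_iota.
  have lc : (falling_poly n)`_n = 1.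
    have := monic_prod_XsubC (iota 0 n) xpredT (fun j => j%:R : rat).
    by rewrite -e monicE lead_coefE sz => /eqP.
  apply/leq_sizeP => j; rewrite leq_eqVlt => /orP[/eqP <-|lt_j].
    by rewrite coefB coefZ lc mulr1 subrr.
  rewrite coefB coefZ (nth_default _ (leq_trans le_n lt_j)).
  by rewrite [(falling_poly n)`_j]nth_default ?sz// mulr0 subrr.
have -> : f = g + f`_n *: falling_poly n by rewrite subrK.
rewrite linearD linearZ /= bernoulli_falling; apply: pabsD_le.
  apply: le_trans (IHn g le_g _) _; last by rewrite ler_wpM2l// ler_nat.
  by apply: coef_leD => //; apply: coef_leN.
rewrite !pabsM pabs_sign mul1r pabsV.
apply: ler_pM; rewrite ?pabs_ge0 ?mulr_ge0 ?invr_ge0 ?pabs_ge0//.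
rewrite -[leRHS]mul1r; apply: ler_pM; rewrite ?pabs_ge0 ?invr_ge0 ?pabs_ge0 ?pabs_nat_le1//.
have := @pabs_product_le _ pp n.+1%:Z isT; rewrite -!pmulrn => h.
by rewrite -[leLHS]mul1r ler_pdivrMr// pabs_gt0 pnatr_eq0.
Qed.

Lemma pabs_bernoulli n : pabs (bernoulli n) <= n.+1%:R.
Proof.
rewrite -bernoulli_funXn -[leRHS]mul1r; apply: bernoulli_fun_le.
  by rewrite size_polyXn.
by move=> i; rewrite coefXn pabs_nat_le1.
Qed.

End BernoulliBound.

Section InverseApproximation.
Variables (p : nat) (pp : prime p).
Local Notation pabs := (pabs pp).
Local Notation coef_le := (coef_le pp).
Local Notation rat_cvg := (rat_cvg pp).
Local Notation rat_null := (rat_null pp).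

Let p0 : 0 < p%:R :> rat. Proof. by rewrite ltr0n prime_gt0. Qed.
Let p1 : 1 < p%:R :> rat. Proof. by rewrite ltr1n prime_gt1. Qed.

(** Polynomials in $t$ that approximate $1/(x+t)$ in the Gauss norm. Flexibility
    in their choice is what replaces the rearrangement of double series. *)
Definition inv_approx (x : rat) (h : nat -> {poly rat}) :=
  (forall K, (size (h K) <= K.+1.*2)%N) /\
  exists2 c, 0 <= c & forall K, coef_le (c / p%:R ^+ K) ((x%:P + 'X) * h K - 1).

Definition geom_poly (x : rat) (K : nat) : {poly rat} :=
  \sum_(j < K) ((-1) ^+ j / x ^+ j.+1) *: 'X^j.

(** $l$ is $\sum_j(-1)^jB_jx^{-j-1}$, the $p$-adic counterpart of the asymptotic
    expansion of $\sum_n 1/(x+n)^2$; it is denoted $\tau(x)$ below. *)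
Definition polygamma_lim (x : rat) (l : padic pp) :=
  rat_cvg (fun K => bernoulli_fun (geom_poly x K)) l.

Lemma bernoulli_geom x K : bernoulli_fun (geom_poly x K) =
  \sum_(j < K) (-1) ^+ j / x ^+ j.+1 * bernoulli j.
Proof.
rewrite /geom_poly raddf_sum /=; apply: eq_bigr => j _.
by rewrite linearZ /= bernoulli_funXn.
Qed.

Lemma coef_le_divX x c (h : {poly rat}) : 1 <= pabs x ->
  coef_le c ((x%:P + 'X) * h) -> coef_le c h.
Proof.
move=> x1 hc i.
have step j : pabs (((x%:P + 'X) * h)`_j - x * h`_j) <= c -> pabs h`_j <= c.
  move=> hj; apply: (@le_trans _ _ (pabs (x * h`_j))).
    by rewrite pabsM ler_peMl ?pabs_ge0.
  rewrite -(subKr ((x%:P + 'X) * h)`_j (x * h`_j)).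
  by apply: pabsD_le; rewrite ?pabsN.
have coef_mul j : ((x%:P + 'X) * h)`_j = x * h`_j + ('X * h)`_j.
  by rewrite mulrDl coefD coefCM.
elim: i => [|i IHi]; apply: step; rewrite coef_mul [x * _ + _]addrC addrK coefXM//=.
by rewrite pabs0; apply: le_trans (hc 0%N); apply: pabs_ge0.
Qed.

Lemma inv_approx_near x h h' : 1 <= pabs x ->
  inv_approx x h -> inv_approx x h' ->
  rat_null (fun K => bernoulli_fun (h K) - bernoulli_fun (h' K)).
Proof.
move=> x1 [sz [c c0 hc]] [sz' [c' c'0 hc']].
apply: (@rat_null_geometric _ pp _ (2 * Num.max c c')) => K.
rewrite -linearB /=.
have -> : 2 * Num.max c c' * K.+1%:R / p%:R ^+ K =
    Num.max c c' / p%:R ^+ K * (K.+1.*2)%:R :> rat.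
  by rewrite -mul2n natrM; ring.
apply: bernoulli_fun_le.
  by apply: leq_trans (size_polyD _ _) _; rewrite size_polyN geq_max sz sz'.
apply: (coef_le_divX x1).
have -> : (x%:P + 'X) * (h K - h' K) =
    ((x%:P + 'X) * h K - 1) - ((x%:P + 'X) * h' K - 1) by ring.
apply: coef_leD; last apply: coef_leN.
  by apply: coef_leW (hc K); rewrite ler_pM2r ?invr_gt0 ?exprn_gt0// le_max lexx.
by apply: coef_leW (hc' K); rewrite ler_pM2r ?invr_gt0 ?exprn_gt0// le_max lexx orbT.
Qed.

Lemma expr_pabs_le x K : p%:R <= pabs x -> pabs (x ^- K) <= (p%:R ^+ K)^-1.
Proof.
move=> xp; rewrite pabsV pabsX lef_pV2 ?posrE ?exprn_gt0 ?(lt_le_trans p0)//.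
by apply: lerXn2r; rewrite ?nnegrE ?pabs_ge0 ?(ltW p0).
Qed.

Lemma geom_polyE x K : x != 0 ->
  (x%:P + 'X) * geom_poly x K = 1 - ((-1) ^+ K / x ^+ K) *: 'X^K.
Proof.
move=> x0; elim: K => [|K IHK].
  by rewrite /geom_poly big_ord0 mulr0 !expr0 divr1 scale1r subrr.
have -> : geom_poly x K.+1 = geom_poly x K + ((-1) ^+ K / x ^+ K.+1) *: 'X^K.
  by rewrite /geom_poly big_ord_recr.
rewrite mulrDr IHK mulrDl -!mul_polyC mulrA -polyCM.
have -> : x * ((-1) ^+ K / x ^+ K.+1) = (-1) ^+ K / x ^+ K.
  by rewrite exprS invfM; field; rewrite x0 expf_neq0.
have -> : (-1) ^+ K.+1 / x ^+ K.+1 = - ((-1) ^+ K / x ^+ K.+1) by rewrite exprS; ring.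
by rewrite polyCN (exprS 'X); ring.
Qed.

Lemma inv_approx_geom x : p%:R <= pabs x -> inv_approx x (geom_poly x).
Proof.
move=> xp; have x0 : x != 0 by rewrite -(pabs_gt0 pp) (lt_le_trans p0).
split=> [K|].
  apply: leq_trans (size_sum _ _ _) _; apply/bigmax_leqP => j _.
  apply: leq_trans (size_scale_leq _ _) _; rewrite size_polyXn.
  by apply: leq_trans (ltn_ord j) _; rewrite -addnn leqW// leq_addr.
exists 1 => // K; rewrite geom_polyE// addrAC subrr add0r; apply: coef_leN.
move=> i; rewrite coefZ coefXn pabsM mul1r -[leRHS]mulr1.
apply: ler_pM; rewrite ?pabs_ge0 ?pabs_nat_le1//.
by rewrite pabsM pabs_sign mul1r expr_pabs_le.
Qed.

Lemma polygamma_lim_exists x : p%:R <= pabs x -> exists l, polygamma_lim x l.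
Proof.
move=> xp.
have le_j j : pabs ((-1) ^+ j / x ^+ j.+1 * bernoulli j) <= j.+1%:R / p%:R ^+ j.+1.
  rewrite 2!pabsM pabs_sign mul1r mulrC; apply: ler_pM; rewrite ?pabs_ge0 ?pabs_bernoulli//.
  exact: expr_pabs_le.
have [||l hl] := @rat_series_cvg _ pp (fun j => (-1) ^+ j / x ^+ j.+1 * bernoulli j).
- move=> j; apply: le_trans (le_j j) _; rewrite ler_pdivrMr ?exprn_gt0// mul1r.
  by rewrite -natrX ler_nat ltnW// ltn_expl// prime_gt1.
- apply: (@rat_null_geometric _ pp _ 1) => j; apply: le_trans (le_j j) _.
  rewrite mul1r ler_pM2l ?ltr0n// lef_pV2 ?posrE ?exprn_gt0//.
  by rewrite ler_weXn2l// ltW.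
- by exists l => e /hl[N hN]; exists N => n /hN; rewrite bernoulli_geom.
Qed.

Lemma inv_approx_cvg x h l : p%:R <= pabs x ->
  inv_approx x h -> polygamma_lim x l -> rat_cvg (fun K => bernoulli_fun (h K)) l.
Proof.
move=> xp hx /rat_cvg_near; apply; apply: inv_approx_near (inv_approx_geom xp) hx.
by apply: le_trans xp; apply: ltW.
Qed.

Lemma cvg_polygamma_lim x h l : p%:R <= pabs x ->
  inv_approx x h -> rat_cvg (fun K => bernoulli_fun (h K)) l -> polygamma_lim x l.
Proof.
move=> xp hx /rat_cvg_near; apply; apply: inv_approx_near hx (inv_approx_geom xp).
by apply: le_trans xp; apply: ltW.
Qed.

(** Because $(x+b)/a+t = (x+(at+b))/a$ and an integral substitution does not
    increase the Gauss norm. *)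
Lemma inv_approx_affine x h (a b : int) : a != 0 -> inv_approx x h ->
  inv_approx ((x + b%:~R) / a%:~R)
    (fun K => a%:~R *: (h K \Po (a%:~R *: 'X + b%:~R%:P))).
Proof.
move=> a0 [sz [c c0 hc]]; have a0' : a%:~R != 0 :> rat by rewrite intr_eq0.
have szq : (size (a%:~R *: 'X + b%:~R%:P : {poly rat})%R <= 2)%N.
  apply: leq_trans (size_polyD _ _) _; rewrite geq_max.
  rewrite (leq_trans (size_scale_leq _ _)) ?size_polyX//=.
  by rewrite (leq_trans (size_polyC_leq1 _)).
split=> [K|].
  apply: leq_trans (size_scale_leq _ _) _.
  apply: leq_trans (size_comp_poly_leq _ _) _.
  apply: (@leq_trans ((size (h K)).-1 * 1).+1).
    by rewrite ltnS leq_mul2l; apply/orP; right; case: (size _) szq.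
  by rewrite muln1; case: (size (h K)) (sz K).
exists c => // K.
have -> : (((x + b%:~R) / a%:~R)%:P + 'X) *
      (a%:~R *: (h K \Po (a%:~R *: 'X + b%:~R%:P))) - 1 =
    ((x%:P + 'X) * h K - 1) \Po (a%:~R *: 'X + b%:~R%:P).
  rewrite comp_polyB comp_polyM comp_polyD comp_polyX !comp_polyC.
  rewrite -scalerAr scalerAl; congr (_ * _ - _).
  by rewrite scalerDr -mul_polyC -polyCM mulrC divfK// polyCD; ring.
apply: coef_le_comp (hc K) _; apply: coef_leD; last exact: coef_le_int.
rewrite -mul_polyC -[1]mulr1; apply: coef_leM; first exact: coef_le_int.
exact: coef_leX.
Qed.

End InverseApproximation.

Arguments polygamma_lim {p} pp x l.

(** * Functional equations *)

Section FunctionalEquations.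
Variables (p : nat) (pp : prime p).
Local Notation Qp := (padic pp).
Local Notation pabs := (pabs pp).
Local Notation rat_cvg := (rat_cvg pp).
Local Notation padic_of_rat := (padic_of_rat pp).
Local Notation polygamma_lim := (polygamma_lim pp).
Local Notation inv_approx := (inv_approx pp).

Let p0 : 0 < p%:R :> rat. Proof. by rewrite ltr0n prime_gt0. Qed.
Let p1 : 1 < p%:R :> rat. Proof. by rewrite ltr1n prime_gt1. Qed.

Lemma polygamma_lim_shift x l : p%:R <= pabs x -> polygamma_lim x l ->
  polygamma_lim (x + 1) (l - padic_of_rat (x ^- 2)).
Proof.
move=> xp xl; have x1 : p%:R <= pabs (x + 1).
  by rewrite pabsD_dominant// pabs1 (lt_le_trans p1).
have := inv_approx_affine (a := 1) 1 isT (inv_approx_geom xp).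
rewrite divr1 scale1r => /(cvg_polygamma_lim x1); apply.
have xl' := rat_cvgB xl (rat_cvg_cst pp (x ^- 2)).
apply: rat_cvg_near xl' _ => e e0; exists 2%N => K le_K.
rewrite scale1r bernoulli_shift.
have -> : (geom_poly x K)`_1 = - x ^- 2.
  rewrite /geom_poly coef_sum (bigD1 (Ordinal le_K)) //= big1 => [|j].
    by rewrite coefZ coefXn eqxx addr0 expr1 mulr1 mulN1r.
  by rewrite -val_eqE /= coefZ coefXn eq_sym => /negbTE ->; rewrite mulr0.
by rewrite subrr pabs0.
Qed.

Lemma polygamma_lim_duplication x l l1 l2 :
  p%:R <= pabs x -> p%:R <= pabs (x / 2) ->
  polygamma_lim x l -> polygamma_lim (x / 2) l1 -> polygamma_lim ((x + 1) / 2) l2 ->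
  l1 + l2 = 4 * l.
Proof.
move=> xp x2p xl xl1 xl2.
have x1 : pabs (x + 1) = pabs x by rewrite pabsD_dominant// pabs1 (lt_le_trans p1).
have x3p : p%:R <= pabs ((x + 1) / 2) by rewrite pabsM x1 -pabsM.
have hx := inv_approx_geom xp.
have := inv_approx_affine (a := 2) 0 isT hx; rewrite addr0 => h1.
have h2 := inv_approx_affine (a := 2) 1 isT hx.
have := rat_cvgD (inv_approx_cvg x2p h1 xl1) (inv_approx_cvg x3p h2 xl2).
move/rat_cvg_unique; apply.
have := rat_cvgZ 4 xl; rewrite rmorph_nat => h e /h[N hN]; exists N => K /hN.
rewrite !linearZ /= -mulrDr addr0 bernoulli_duplication mulrA.
by have -> : 2 * 2 = 4 :> rat by [].
Qed.

(** An approximation to $1/(x^2-t^2)$, with $y = x^2$, by Newton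
    interpolation at the squares; the form chosen has $t^2$ in front of each basis
    element, so that the functional turns it into [newton_sum]. *)
Definition newton_poly (y : rat) (K : nat) : {poly rat} :=
  y^-1 *: (1 + \sum_(k < K) (node_prod y k.+1)^-1 *: ('X^2 * even_prod k)).

Lemma genocchi_newton_poly y K :
  genocchi_fun (newton_poly y K) = - newton_sum y K / y.
Proof.
rewrite /newton_poly linearZ linearD raddf_sum /= genocchi1 add0r mulrC.
congr (_ / _); rewrite /newton_sum -sumrN; apply: eq_bigr => k _.
by rewrite linearZ /= genocchi_X2_even_prod /newton_term; ring.
Qed.

Lemma newton_polyE y K : y != 0 -> (forall k, node_prod y k != 0) ->
  (y%:P - 'X^2) * newton_poly y K =
  1 - (y * node_prod y K)^-1 *: ('X^2 * even_prod K).
Proof.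
move=> y0 node0; elim: K => [|K IHK].
  rewrite /newton_poly /node_prod /even_prod !big_ord0 addr0 !mulr1.
  rewrite -!mul_polyC mulr1 mulrBl [_ * y^-1%:P]mulrC -polyCM mulVf//; ring.
have -> : newton_poly y K.+1 = newton_poly y K +
    (y * node_prod y K.+1)^-1 *: ('X^2 * even_prod K).
  rewrite /newton_poly big_ord_recr /= addrA scalerDr scalerA.
  by congr (_ + _ *: _); rewrite invfM.
rewrite mulrDr IHK even_prodS -!mul_polyC.
have -> : y%:P - 'X^2 = (y - K%:R ^+ 2)%:P - ('X^2 - (K%:R ^+ 2)%:P).
  by rewrite polyCB; ring.
have e : (y * node_prod y K)^-1 = (y * node_prod y K.+1)^-1 * (y - K%:R ^+ 2).
  have := node0 K.+1; rewrite node_prodS mulf_eq0 negb_or => /andP[a0 b0].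
  by field; rewrite y0 a0 b0.
by rewrite e polyCM; ring.
Qed.

Lemma size_newton_poly y K : (size (newton_poly y K) <= K.*2.+1)%N.
Proof.
have sz k : (size (even_prod k) <= k.*2.+1)%N.
  elim: k => [|k IHk]; first by rewrite /even_prod big_ord0 size_poly1.
  rewrite even_prodS; apply: leq_trans (size_polyMleq _ _) _.
  have : (size ('X^2 - (k%:R ^+ 2)%:P : {poly rat})%R <= 3)%N.
    by rewrite size_XnsubC.
  by move: IHk; rewrite doubleS; lia.
rewrite /newton_poly; apply: leq_trans (size_scale_leq _ _) _.
apply: leq_trans (size_polyD _ _) _; rewrite size_poly1 geq_max /=.
apply: leq_trans (size_sum _ _ _) _; apply/bigmax_leqP => k _.
apply: leq_trans (size_scale_leq _ _) _; apply: leq_trans (size_polyMleq _ _) _.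
rewrite size_polyXn /=; apply: (@leq_trans (2 + k.*2.+1)).
  by rewrite leq_add2l; apply: sz.
by rewrite addnS ltnS add2n -doubleS leq_double.
Qed.

Lemma inv_approx_newton x : p%:R <= pabs x ->
  inv_approx x (fun K => (x%:P - 'X) * newton_poly (x ^+ 2) K).
Proof.
move=> xp; set y := x ^+ 2.
have y_p : p%:R <= pabs y.
  rewrite /y pabsX expr2; apply: (le_trans xp).
  by rewrite ler_peMl ?pabs_ge0//; exact: le_trans (ltW p1) xp.
have y1 : 1 < pabs y by rewrite (lt_le_trans p1).
have y0 : y != 0 by rewrite -(pabs_gt0 pp) (lt_le_trans p0).
have node0 k : node_prod y k != 0.
  by apply: node_prod_neq0; apply: (node_neq0 y1).
split=> [K|].
  apply: leq_trans (size_polyMleq _ _) _; have := size_newton_poly y K.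
  rewrite -opprB size_polyN size_XsubC doubleS; lia.
exists 1 => // K; rewrite mulrA.
have -> : (x%:P + 'X) * (x%:P - 'X) = y%:P - 'X^2.
  by rewrite /y expr2 polyCM; ring.
rewrite newton_polyE// addrAC subrr add0r; apply: coef_leN.
have X2 : coef_le pp 1 'X^2.
  by have := coef_leM (coef_leX pp) (coef_leX pp); rewrite mulr1 -expr2.
have even1 : coef_le pp 1 ('X^2 * even_prod K).
  rewrite -[1]mulr1; apply: (coef_leM X2).
  apply: coef_le_prod => j; apply: coef_leD; first exact: X2.
  rewrite -polyCN; have -> : - (j%:R ^+ 2) = (- (j%:Z ^+ 2))%:~R :> rat.
    by rewrite mulrNz rmorphXn /= -pmulrn.
  exact: coef_le_int.
apply: coef_leW (coef_leZ _ even1).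
rewrite mulr1 mul1r pabsV pabsM pabs_node_prod// lef_pV2 ?posrE ?exprn_gt0//; last first.
  by rewrite mulr_gt0 ?exprn_gt0 ?(lt_trans ltr01 y1).
apply: (@le_trans _ _ (pabs y ^+ K)).
  by apply: lerXn2r; rewrite ?nnegrE ?pabs_ge0 ?(ltW p0).
by rewrite ler_peMl ?exprn_ge0 ?pabs_ge0 ?ltW.
Qed.

(** With $\Theta(x) = (\tau(x/2)-\tau((x+1)/2))/4$, the $p$-adic
    $\sum_n(-1)^n/(x+n)^2$, the difference $\Theta(x)-\Theta(-x)$ only sees the even
    function $1/(x+t)+1/(x-t) = 2x/(x^2-t^2)$. *)
Lemma newton_sum_cvg x l1 l2 l3 l4 :
  p%:R <= pabs x -> p%:R <= pabs (x / 2) ->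
  polygamma_lim (x / 2) l1 -> polygamma_lim ((x + 1) / 2) l2 ->
  polygamma_lim (- x / 2) l3 -> polygamma_lim ((- x + 1) / 2) l4 ->
  rat_cvg (newton_sum (x ^+ 2)) (padic_of_rat (x / 4) * (l1 - l2 - (l3 - l4))).
Proof.
move=> xp x2p xl1 xl2 xl3 xl4; set y := x ^+ 2.
have x0 : x != 0 by rewrite -(pabs_gt0 pp) (lt_le_trans p0).
have half z : pabs z = pabs x ->
    p%:R <= pabs (z / 2) /\ p%:R <= pabs ((z + 1) / 2).
  move=> zx; have z1 : pabs (z + 1) = pabs z.
    by rewrite pabsD_dominant// pabs1 zx (lt_le_trans p1).
  by rewrite !(pabsM _ _ 2^-1) z1 zx -pabsM.
have theta z h m1 m2 : pabs z = pabs x -> inv_approx z h ->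
    polygamma_lim (z / 2) m1 -> polygamma_lim ((z + 1) / 2) m2 ->
    rat_cvg (fun K => - 2 * genocchi_fun (h K)) (m1 - m2).
  move=> /half[z2p z3p] hz zm1 zm2.
  have := inv_approx_affine (a := 2) 0 isT hz; rewrite addr0 => h1.
  have h2 := inv_approx_affine (a := 2) 1 isT hz.
  have := rat_cvgB (inv_approx_cvg z2p h1 zm1) (inv_approx_cvg z3p h2 zm2).
  move=> h' e /h'[N hN]; exists N => K /hN; rewrite /genocchi_fun !linearZ /= addr0.
  have -> : (1%:~R)%:P = 1 :> {poly rat} by [].
  have -> : 2%:~R = 2 :> rat by [].
  have E (u v : rat) : - 2 * (u - v) = 2 * v - 2 * u by ring.
  by rewrite E.
have hx := inv_approx_newton xp.
have := inv_approx_affine (a := -1) 0 isT hx.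
have -> : (x + 0%:~R) / (-1)%:~R = - x by rewrite addr0 invrN1 mulrN1.
move/theta => /(_ _ _ (pabsN _ _) xl3 xl4) t2.
have t1 := theta _ _ _ _ erefl hx xl1 xl2.
have := rat_cvgZ (x / 4) (rat_cvgB t1 t2) => h e /h[N hN]; exists N => K /hN.
rewrite -mulrBr -linearB /=.
set f : {poly rat} := _ - _ *: _; have -> : f = (2 * x) *: newton_poly y K.
  rewrite /f; have -> : (-1)%:~R = -1 :> rat by [].
  rewrite addr0 -/y scaleN1r opprK comp_polyM comp_polyB comp_polyX comp_polyC.
  rewrite scaleN1r opprK.
  have -> : newton_poly y K \Po - 'X = newton_poly y K.
    rewrite /newton_poly comp_polyZ comp_polyD comp_polyC raddf_sum /=.
    congr (_ *: (_ + _)); apply: eq_bigr => k _; rewrite comp_polyZ comp_polyM.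
    rewrite comp_Xn_poly sqrrN; congr (_ *: (_ * _)).
    rewrite /even_prod (rmorph_prod (comp_poly (- 'X))) /=; apply: eq_bigr => j _.
    by rewrite comp_polyB comp_Xn_poly sqrrN comp_polyC.
  by rewrite -mul_polyC polyCM rmorph_nat; ring.
rewrite linearZ /= genocchi_newton_poly.
have -> // : x / 4 * (- 2 * (2 * x * (- newton_sum y K / y))) = newton_sum y K.
by rewrite /y; field.
Qed.

End FunctionalEquations.

(** * Values of the L-functions at 2 *)

Section HurwitzAtTwo.
Variables (p : nat) (pp : prime p).
Local Notation Zp := (padic_int pp).
Local Notation Qp := (padic pp).
Local Notation pabs := (pabs pp).
Local Notation padic_of_rat := (padic_of_rat pp).

Let p0 : 0 < p%:R :> rat. Proof. by rewrite ltr0n prime_gt0. Qed.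
Let p1 : 1 < p%:R :> rat. Proof. by rewrite ltr1n prime_gt1. Qed.

Lemma padic_of_int_1sub2 : padic_of_int (1 - 2 : Zp) = -1.
Proof. by rewrite rmorphB rmorph1 rmorph_nat opprD addrA subrr sub0r. Qed.

Lemma padic_binomialN1 j : padic_binomial (-1 : Qp) j = (-1) ^+ j.
Proof.
have f0 : (j`!%:R : Qp) != 0 by apply: padic_natr_neq0; rewrite fact_gt0.
apply: (mulIf f0); rewrite /padic_binomial divfK//.
rewrite fact_prod big_add1 big_mkord natr_prod -[X in (-1) ^+ X](card_ord j).
rewrite -prodr_const -big_split /=; apply: eq_bigr => i _.
by rewrite -addn1 natrD; ring.
Qed.

Lemma padic_powN1 (u : rat) : pabs (u - 1) <= p%:R^-1 ->
  padic_pow (padic_of_rat u) (1 - 2) = padic_of_rat u^-1.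
Proof.
move=> u_near.
have u1 : pabs u = 1.
  rewrite -[u](subrK 1) addrC pabsD_dominant ?pabs1//.
  by apply: le_lt_trans u_near _; rewrite invf_lt1.
have u0 : u != 0 by rewrite -(pabs_gt0 pp) u1.
apply: (@rat_cvg_series _ _ (fun j => (1 - u) ^+ j)) => [j|].
  have -> : padic_of_rat u - 1 = padic_of_rat (u - 1) by rewrite rmorphB rmorph1.
  rewrite padic_of_int_1sub2 padic_binomialN1.
  by rewrite -exprMn mulN1r -rmorphN opprB rmorphXn.
apply: rat_cvg_near (rat_cvg_cst pp u^-1) _.
apply: (@rat_null_geometric _ pp _ 1) => n.
have -> : u^-1 - \sum_(j < n) (1 - u) ^+ j = (1 - u) ^+ n / u.
  apply: (mulIf u0); rewrite mulrBl divfK// mulVf//.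
  by rewrite -[RHS](subrK 1) subrX1; ring.
rewrite pabsM pabsV u1 divr1 pabsX pabsB mul1r.
apply: (@le_trans _ _ (p%:R^-1 ^+ n)).
  by apply: lerXn2r; rewrite ?nnegrE ?pabs_ge0 ?invr_ge0 ?(ltW p0).
by rewrite exprVn ler_peMl ?invr_ge0 ?exprn_ge0 ?(ltW p0)// ler1n.
Qed.

(** At $s = 2$ the binomial coefficients of $1-s = -1$ are signs, and the
    Hurwitz series becomes the moment series of the Bernoulli functional. *)
Lemma hurwitz_at_2 (a F : nat) (w : int) (l : Qp) :
  w * w = 1 -> teichmuller pp a = w%:~R -> (p%:Z %| w * a%:Z - 1)%Z ->
  (0 < a)%N -> (0 < F)%N -> polygamma_lim pp (a%:R / F%:R) l ->
  padic_hurwitz (2 : Zp) a F = padic_of_rat (w%:~R / F%:R ^+ 2) * l.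
Proof.
move=> ww teich wa a0 F0 hl.
have a0' : a%:R != 0 :> rat by rewrite pnatr_eq0 -lt0n.
have F0' : F%:R != 0 :> rat by rewrite pnatr_eq0 -lt0n.
have ww' : w%:~R * w%:~R = 1 :> rat by rewrite -intrM ww.
have w0 : w%:~R != 0 :> rat.
  by apply: contra_eq_neq ww' => ->; rewrite mul0r eq_sym oner_eq0.
have angle : padic_angle pp a = padic_of_rat (w%:~R * a%:R).
  rewrite /padic_angle teich rmorph_int rmorphM rmorph_int rmorph_nat -pmulrn.
  congr (_ * _); rewrite -(rmorph_int padic_of_rat) -fmorphV.
  by congr (padic_of_rat _); apply: (mulfI w0); rewrite ww' divff.
have series_l : padic_series (fun j => padic_binomial (padic_of_int (1 - 2 : Zp)) j *
    ratr (bernoulli j) * (F%:R / a%:~R) ^+ j) = padic_of_rat (a%:R / F%:R) * l.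
  apply: (@rat_cvg_series _ _ (fun j => (-1) ^+ j * bernoulli j * (F%:R / a%:R) ^+ j)).
    move=> j; rewrite padic_of_int_1sub2 padic_binomialN1 2!rmorphM.
    by rewrite !rmorphXn rmorphN1 fmorph_div !rmorph_nat -pmulrn.
  have sumE n : \sum_(j < n) (-1) ^+ j * bernoulli j * (F%:R / a%:R) ^+ j =
      a%:R / F%:R * bernoulli_fun (geom_poly (a%:R / F%:R) n).
    rewrite bernoulli_geom big_distrr /=; apply: eq_bigr => j _.
    rewrite exprS invfM -exprVn invf_div; move: (_ ^+ j) (bernoulli j) => u v.
    by move: (_ ^+ j) => z; field; rewrite a0' F0'.
  have hl' := rat_cvgZ (a%:R / F%:R) hl.
  by move=> e e0; have [N hN] := hl' e e0; exists N => n /hN; rewrite sumE.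
rewrite /padic_hurwitz angle padic_powN1; last first.
  by have := @pabs_int_dvd _ pp (w * a%:Z - 1) 1; rewrite expn1 wa intrB intrM -pmulrn expr1.
rewrite series_l rmorph_nat -[2 - 1]/(1 + 1 - 1) addrK mulr1.
rewrite -[F%:R](rmorph_nat padic_of_rat) -fmorphV mulrA -!rmorphM.
congr (padic_of_rat _ * l).
have wV : w%:~R^-1 = w%:~R :> rat by apply: (mulfI w0); rewrite ww' divff.
by rewrite invfM wV; field; rewrite a0' F0'.
Qed.

End HurwitzAtTwo.

Lemma teichmuller2 (k : nat) :
  teichmuller prime2 k.*2.+1 = ((-1) ^+ k : int)%:~R.
Proof.
rewrite /teichmuller -[(_ %| _)%Z]/(2 %| k.*2.+1)%N dvdn2 /= odd_double /=.
have -> : ((k.*2.+1%:Z - 1) %/ 2)%Z = k.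
  by rewrite -addn1 PoszD addrK -mul2n PoszM mulKz.
by rewrite -exprnP rmorphXn rmorphN1.
Qed.

(** For $p = 3$ the defining equation $w^2 = 1$ has only the solutions
    $\pm 1$. *)
Lemma teichmuller3 (a : nat) (w : int) : ~~ (3 %| a)%N ->
  w * w = 1 -> (w = a %[mod 3])%Z -> teichmuller prime3 a = w%:~R.
Proof.
move=> a3 ww wa; rewrite /teichmuller -[(_ %| _)%Z]/(3 %| a)%N (negbTE a3) /=.
set S := [set _ | _]%classic.
have res1 (z : int) : (z%:~R : padic_int prime3) 1%N = (z %% 3)%Z.
  case: z => m; first by rewrite -pmulrn padic_int_natE.
  by rewrite NegzE mulrNz -pmulrn padic_intNE padic_int_natE modzNm.
have Sw : S w%:~R.
  split; first by rewrite expr2 -intrM ww.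
  by rewrite res1 modz_mod.
have [] : S (xget 0 S) by apply: (@xgetPex _ 0 S); exists w%:~R.
set v := xget 0 S => v2 va.
have v_or : v = w%:~R \/ v = - w%:~R.
  have : (v - w%:~R) * (v + w%:~R) = 0.
    by rewrite -subr_sqr v2 expr2 -intrM ww subrr.
  move/eqP; rewrite mulf_eq0 subr_eq0 addr_eq0.
  by case/orP => /eqP; [left | right].
case: v_or => // ev; exfalso; move: va.
rewrite ev -mulrNz res1 modz_mod -wa => /eqP; rewrite eqz_mod_dvd.
have [->|->] : w = 1 \/ w = -1; last 2 first.
- by [].
- by [].
have : (w - 1) * (w + 1) = 0 by rewrite mulrDr mulrBl ww; ring.
by move/eqP; rewrite mulf_eq0 subr_eq0 addr_eq0; case/orP=> /eqP; [left|right].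
Qed.

Lemma pabs_frac_ge (p : nat) (pp : prime p) (a F : nat) :
  coprime p a -> (p %| F)%N -> (0 < F)%N -> p%:R <= pabs pp (a%:R / F%:R).
Proof.
move=> pa pF F0; have p0 : 0 < p%:R :> rat by rewrite ltr0n prime_gt0.
have a0 : (0 < a)%N.
  case: posnP pa => // ->; rewrite /coprime gcdn0 => /eqP e.
  by move: (prime_gt1 pp); rewrite e.
rewrite pabsM pabsV !pabs_nat// logn_coprime// expr0 invr1 mul1r invrK.
rewrite -[leLHS]expr1; apply: ler_weXn2l; first by rewrite ler1n prime_gt0.
by rewrite logn_gt0 mem_primes pp F0.
Qed.

Lemma padic_of_rat_mul_eq (p : nat) (pp : prime p) (c q : rat) (l : padic pp) :
  c != 0 -> padic_of_rat pp c * l = padic_of_rat pp q -> l = padic_of_rat pp (q / c).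
Proof.
move=> c0 e; rewrite fmorph_div /= -e mulrAC divff ?mul1r//.
by rewrite fmorph_eq0.
Qed.

Lemma newton_limit_irrational (p : nat) (pp : prime p) (r : nat) (x beta : rat)
    (l : padic pp) : (0 < r)%N ->
  (forall j, (2 < j)%N ->
     (2 ^ (6 ^ j) * 432 ^ (8 * 6 ^ j) <= binom_clear p r (6 ^ j) ^ 40)%N) ->
  x = 1%:R / (p ^ r)%:R -> l = padic_of_rat pp beta ->
  ~ rat_cvg pp (newton_sum (x ^+ 2)) l.
Proof.
move=> r0 large -> -> /rat_cvg_rat.
apply: (@newton_sum_irrational p pp r 1) => //; first by rewrite coprimen1.
by rewrite lez_nat expn_gt0 prime_gt0.
Qed.

(** The finite sums are expanded over an abstract ring, so that no computation
    with the elements of the $p$-adic field is attempted. *)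
Lemma sum_units_4 (R : nzRingType) (f : nat -> R) :
  \sum_(1 <= a < 5 | ~~ (2 %| a)%N) 1 * f a = f 1%N + f 3%N.
Proof. by rewrite /index_iota /= !big_cons big_nil /= !mul1r addr0. Qed.

Lemma sum_units_3 (R : nzRingType) (f : nat -> R) :
  \sum_(1 <= a < 4 | ~~ (3 %| a)%N) 1 * f a = f 1%N + f 2%N.
Proof. by rewrite /index_iota /= !big_cons big_nil /= !mul1r addr0. Qed.

Lemma sum_units_8 (R : nzRingType) (f : nat -> R) :
  \sum_(1 <= a < 9 | ~~ (2 %| a)%N) (chi8 a)%:~R * f a =
  f 1%N - f 3%N - f 5%N + f 7%N.
Proof.
rewrite /index_iota /= !big_cons big_nil /=.
have -> : chi8 1%N = 1 by []. have -> : chi8 3%N = -1 by [].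
have -> : chi8 5%N = -1 by []. have -> : chi8 7%N = 1 by [].
by rewrite !mulrNz !mulNr !mul1r addr0 !addrA.
Qed.

Lemma linear_comb8 (R : comNzRingType) (c a b d e : R) :
  c * a - - c * b - c * d + - c * e = c * (a + b - d - e).
Proof. by ring. Qed.

Lemma padic_zeta2_2 : padic_zeta prime2 2 =
  padic_hurwitz (2 : padic_int prime2) 1%N 4 + padic_hurwitz (2 : padic_int prime2) 3%N 4.
Proof. exact: (sum_units_4 (fun a => padic_hurwitz (2 : padic_int prime2) a 4)). Qed.

Lemma padic_zeta3_2 : padic_zeta prime3 2 =
  padic_hurwitz (2 : padic_int prime3) 1%N 3 + padic_hurwitz (2 : padic_int prime3) 2%N 3.
Proof. exact: (sum_units_3 (fun a => padic_hurwitz (2 : padic_int prime3) a 3)). Qed.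

Lemma padic_L2_chi8_2 :
  padic_L prime2 2 8 (fun a : int => (chi8 a)%:~R) =
  padic_hurwitz (2 : padic_int prime2) 1%N 8 - padic_hurwitz (2 : padic_int prime2) 3%N 8
  - padic_hurwitz (2 : padic_int prime2) 5%N 8 + padic_hurwitz (2 : padic_int prime2) 7%N 8.
Proof. exact: (sum_units_8 (fun a => padic_hurwitz (2 : padic_int prime2) a 8)). Qed.

Lemma hurwitz2_at_2 (k F : nat) (l : padic prime2) :
  (0 < F)%N -> polygamma_lim prime2 (k.*2.+1%:R / F%:R) l ->
  padic_hurwitz (2 : padic_int prime2) k.*2.+1 F =
  padic_of_rat prime2 ((-1) ^+ k / F%:R ^+ 2) * l.
Proof.
move=> F0 hl.
rewrite (hurwitz_at_2 _ (teichmuller2 k) _ _ F0 hl) ?rmorphXn ?rmorphN1//.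
  by rewrite -exprD addnn -mul2n exprM sqrrN !expr1n.
rewrite -addn1 PoszD -mul2n PoszM -signr_odd; apply/dvdzP.
by case: (odd k); [exists (- k%:Z - 1) | exists k%:Z]; rewrite ?expr1 ?expr0; ring.
Qed.

Lemma hurwitz3_at_2 (a F : nat) (w : int) (l : padic prime3) :
  ~~ (3 %| a)%N -> w * w = 1 -> (w = a %[mod 3])%Z ->
  (0 < F)%N -> polygamma_lim prime3 (a%:R / F%:R) l ->
  padic_hurwitz (2 : padic_int prime3) a F =
  padic_of_rat prime3 (w%:~R / F%:R ^+ 2) * l.
Proof.
move=> a3 ww wa F0 hl; have a0 : (0 < a)%N by case: posnP a3 => // ->.
apply: (hurwitz_at_2 ww (teichmuller3 a3 ww wa) _ a0 F0 hl).
by rewrite -eqz_mod_dvd -ww -modzMmr -wa modzMmr.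
Qed.

Local Notation rat2 := (padic_of_rat prime2).
Local Notation rat3 := (padic_of_rat prime3).

(** With $\tau$ the limit of the Bernoulli series, $16\,\zeta_2(2) =
    \tau(1/4)-\tau(3/4)$, and $x = 1/2$ in [newton_sum_cvg] involves the same two
    values, since $\tau(-1/4) = \tau(3/4)+16$. *)
Lemma zeta2_2_irrational : padic_irrational (padic_zeta prime2 2).
Proof.
case=> q zeta_q.
have g1 : 2%:R <= pabs prime2 (1%:R / 4%:R) by apply: pabs_frac_ge.
have g3 : 2%:R <= pabs prime2 (- (1%:R / 4%:R)) by rewrite pabsN.
have gx : 2%:R <= pabs prime2 (1%:R / 2%:R) by apply: pabs_frac_ge.
have [l1 h1] := polygamma_lim_exists g1.
have [l3 h3] := polygamma_lim_exists g3.
have h2 := polygamma_lim_shift g3 h3.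
rewrite (_ : - (1%:R / 4%:R) + 1 = 3%:R / 4%:R) // in h2.
rewrite (_ : (- (1%:R / 4%:R)) ^- 2 = 16) // in h2.
have z1 := hurwitz2_at_2 (k := 0) (F := 4) isT h1.
have z2 := hurwitz2_at_2 (k := 1) (F := 4) isT h2.
rewrite (_ : (-1) ^+ 0 / 4%:R ^+ 2 = 16^-1) // in z1.
rewrite (_ : (-1) ^+ 1 / 4%:R ^+ 2 = - 16^-1) // in z2.
have zE := etrans (etrans (esym zeta_q) padic_zeta2_2) (congr2 +%R z1 z2).
have lE : l1 - (l3 - rat2 16) = rat2 (q / 16^-1).
  apply: padic_of_rat_mul_eq; first by [].
  by rewrite -[rat2 q]/(ratr q) zE rmorphN mulNr mulrBr.
have e1 : 1%:R / 2%:R / 2 = 1%:R / 4%:R :> rat by [].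
have e2 : (1%:R / 2%:R + 1) / 2 = 3%:R / 4%:R :> rat by [].
have e3 : - (1%:R / 2%:R) / 2 = - (1%:R / 4%:R) :> rat by [].
have e4 : (- (1%:R / 2%:R) + 1) / 2 = 1%:R / 4%:R :> rat by [].
have gx2 : 2%:R <= pabs prime2 (1%:R / 2%:R / 2) by rewrite e1.
have h4 := h1; rewrite -e1 in h1; rewrite -e2 in h2; rewrite -e3 in h3.
rewrite -e4 in h4; have := newton_sum_cvg gx gx2 h1 h2 h3 h4.
apply: (@newton_limit_irrational _ _ 1 _ (1%:R / 2%:R / 4 * (2 * (q / 16^-1) - 16))).
- by [].
- by move=> j; apply: binom_clear2_large.
- by [].
- rewrite [RHS]rmorphM; congr (_ * _).
  by rewrite rmorphB rmorphM /= -lE (rmorph_nat _ 2); ring.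
Qed.

(** Here $64\,L_2(2,\chi_8) = \tau(1/8)+\tau(3/8)-\tau(5/8)-\tau(7/8)$: the signs of
    $\chi_8$ and of the Teichmueller character multiply to those of the alternating
    function at $x = \pm1/4$. *)
Lemma L2_chi8_2_irrational :
  padic_irrational (padic_L prime2 2 8 (fun a : int => (chi8 a)%:~R)).
Proof.
case=> q L_q.
have g1 : 2%:R <= pabs prime2 (1%:R / 8%:R) by apply: pabs_frac_ge.
have g2 : 2%:R <= pabs prime2 (5%:R / 8%:R) by apply: pabs_frac_ge.
have g3 : 2%:R <= pabs prime2 (- (1%:R / 8%:R)) by rewrite pabsN.
have g4 : 2%:R <= pabs prime2 (3%:R / 8%:R) by apply: pabs_frac_ge.
have gx : 2%:R <= pabs prime2 (1%:R / 4%:R) by apply: pabs_frac_ge.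
have [l1 h1] := polygamma_lim_exists g1.
have [l2 h2] := polygamma_lim_exists g2.
have [l3 h3] := polygamma_lim_exists g3.
have [l4 h4] := polygamma_lim_exists g4.
have h7 := polygamma_lim_shift g3 h3.
rewrite (_ : - (1%:R / 8%:R) + 1 = 7%:R / 8%:R) // in h7.
rewrite (_ : (- (1%:R / 8%:R)) ^- 2 = 64) // in h7.
have z1 := hurwitz2_at_2 (k := 0) (F := 8) isT h1.
have z3 := hurwitz2_at_2 (k := 1) (F := 8) isT h4.
have z5 := hurwitz2_at_2 (k := 2) (F := 8) isT h2.
have z7 := hurwitz2_at_2 (k := 3) (F := 8) isT h7.
rewrite (_ : (-1) ^+ 0 / 8%:R ^+ 2 = 64^-1) // in z1.
rewrite (_ : (-1) ^+ 1 / 8%:R ^+ 2 = - 64^-1) // in z3.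
rewrite (_ : (-1) ^+ 2 / 8%:R ^+ 2 = 64^-1) // in z5.
rewrite (_ : (-1) ^+ 3 / 8%:R ^+ 2 = - 64^-1) // in z7.
have zE := etrans (etrans (esym L_q) padic_L2_chi8_2)
  (congr2 +%R (congr2 (fun a b => a - b) (congr2 (fun a b => a - b) z1 z3) z5) z7).
have cN : rat2 (- 64^-1) = - rat2 64^-1 by rewrite rmorphN.
have lE : l1 + l4 - l2 - (l3 - rat2 64) = rat2 (q / 64^-1).
  apply: padic_of_rat_mul_eq; first by [].
  apply: etrans (esym (linear_comb8 _ _ _ _ _)) _; rewrite -cN; exact: esym zE.
have e1 : 1%:R / 4%:R / 2 = 1%:R / 8%:R :> rat by [].
have e2 : (1%:R / 4%:R + 1) / 2 = 5%:R / 8%:R :> rat by [].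
have e3 : - (1%:R / 4%:R) / 2 = - (1%:R / 8%:R) :> rat by [].
have e4 : (- (1%:R / 4%:R) + 1) / 2 = 3%:R / 8%:R :> rat by [].
have gx2 : 2%:R <= pabs prime2 (1%:R / 4%:R / 2) by rewrite e1.
rewrite -e1 in h1; rewrite -e2 in h2; rewrite -e3 in h3; rewrite -e4 in h4.
have := newton_sum_cvg gx gx2 h1 h2 h3 h4.
apply: (@newton_limit_irrational _ _ 2 _ (1%:R / 4%:R / 4 * (q / 64^-1 - 64))).
- by [].
- by move=> j; apply: binom_clear2_large.
- by [].
- by rewrite [RHS]rmorphM; congr (_ * _); rewrite rmorphB /= -lE; ring.
Qed.

(** Here $9\,\zeta_3(2) = \tau(1/3)-\tau(2/3)$. The point $x = 1/3$ also brings in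
    $\tau(1/6)$ and $\tau(5/6)$, which duplication expresses by $\tau(1/3)$ and
    $\tau(2/3)$. *)
Lemma zeta3_2_irrational : padic_irrational (padic_zeta prime3 2).
Proof.
case=> q zeta_q.
have g1 : 3%:R <= pabs prime3 (1%:R / 6%:R) by apply: pabs_frac_ge.
have g2 : 3%:R <= pabs prime3 (2%:R / 3%:R) by apply: pabs_frac_ge.
have g3 : 3%:R <= pabs prime3 (- (1%:R / 6%:R)) by rewrite pabsN.
have gx : 3%:R <= pabs prime3 (1%:R / 3%:R) by apply: pabs_frac_ge.
have [l1 h1] := polygamma_lim_exists g1.
have [l2 h2] := polygamma_lim_exists g2.
have [l3 h3] := polygamma_lim_exists g3.
have [l4 h4] := polygamma_lim_exists gx.
have h5 := polygamma_lim_shift g3 h3.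
rewrite (_ : - (1%:R / 6%:R) + 1 = 5%:R / 6%:R) // in h5.
rewrite (_ : (- (1%:R / 6%:R)) ^- 2 = 36) // in h5.
have z1 := hurwitz3_at_2 (a := 1) (w := 1) (F := 3) isT erefl erefl isT h4.
have z2 := hurwitz3_at_2 (a := 2) (w := -1) (F := 3) isT erefl erefl isT h2.
rewrite (_ : 1%:~R / 3%:R ^+ 2 = 9^-1) // in z1.
rewrite (_ : (-1)%:~R / 3%:R ^+ 2 = - 9^-1) // in z2.
have zE := etrans (etrans (esym zeta_q) padic_zeta3_2) (congr2 +%R z1 z2).
have lE : l4 - l2 = rat3 (q / 9^-1).
  apply: padic_of_rat_mul_eq; first by [].
  by rewrite -[rat3 q]/(ratr q) zE rmorphN mulNr mulrBr.
have e1 : 1%:R / 3%:R / 2 = 1%:R / 6%:R :> rat by [].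
have e2 : (1%:R / 3%:R + 1) / 2 = 2%:R / 3%:R :> rat by [].
have e3 : - (1%:R / 3%:R) / 2 = - (1%:R / 6%:R) :> rat by [].
have e4 : (- (1%:R / 3%:R) + 1) / 2 = 1%:R / 3%:R :> rat by [].
have e5 : 2%:R / 3%:R / 2 = 1%:R / 3%:R :> rat by [].
have e6 : (2%:R / 3%:R + 1) / 2 = 5%:R / 6%:R :> rat by [].
have gx2 : 3%:R <= pabs prime3 (1%:R / 3%:R / 2) by rewrite e1.
have gy2 : 3%:R <= pabs prime3 (2%:R / 3%:R / 2) by rewrite e5.
have h1' := h1; have h2' := h2; have h4' := h4; have h4'' := h4.
rewrite -e1 in h1'; rewrite -e2 in h2'; rewrite -e3 in h3; rewrite -e4 in h4'.
rewrite -e5 in h4''; rewrite -e6 in h5.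
have d1 := polygamma_lim_duplication gx gx2 h4 h1' h2'.
have d2 := polygamma_lim_duplication g2 gy2 h2 h4'' h5.
have := newton_sum_cvg gx gx2 h1' h2' h3 h4'.
apply: (@newton_limit_irrational _ _ 1 _ (1%:R / 3%:R / 4 * (6 * (q / 9^-1) - 36))).
- by [].
- by move=> j j3; apply: binom_clear3_large; last exact: ltnW (ltnW j3).
- by [].
- rewrite [RHS]rmorphM; congr (_ * _); rewrite rmorphB rmorphM /= -lE (rmorph_nat _ 6).
  have -> : l1 = 4 * l4 - l2 by rewrite -d1 addrK.
  have -> : l3 = 4 * l2 - l4 + rat3 36.
    by rewrite -d2 [l4 + _]addrC addrK subrK.
  by ring.
Qed.

Theorem corollary7p3 :
  [/\ padic_irrational (padic_zeta prime2 2),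
      padic_irrational (padic_zeta prime3 2) &
      padic_irrational
        (padic_L prime2 2 8 (fun a : int => (chi8 a)%:~R))].
Proof.
split.
- exact: zeta2_2_irrational.
- exact: zeta3_2_irrational.
- exact: L2_chi8_2_irrational.
Qed.
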